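(* Let $\Gamma<\mathrm{Isom}(\mathbb H^k)$ be an infinite, non-elementary discrete group, and let $\rho:\Gamma\to\mathrm{Isom}(\mathbb H^n)$ be a representation. Then a family of developing measures for $\rho$ exists, i.e. there is a set $\{\lambda_z\}_{z\in\partial\mathbb H^k}$ of positive Borel measures on $\partial\mathbb H^n$, of finite mass, such that: (1) for $\mu_O$-almost all $z$ and all $\gamma\in\Gamma$, $\lambda_{\gamma z}=\rho(\gamma)_*\lambda_z$; (2) for every $\varphi\in C(\partial\mathbb H^n)$ the function $z\mapsto\int_{\partial\mathbb H^n}\varphi\,d\lambda_z$ is $\mu_O$-integrable; (3) the function $z\mapsto\|\lambda_z\|$ belongs to $L^\infty(\partial\mathbb H^k,\mu_O)$; (4) $\|\lambda_z\|>0$ for $\mu_O$-almost all $z\in\partial\mathbb H^k$.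
   Context: $\mathrm{Isom}(\mathbb H^m)$ is the isometry group of hyperbolic $m$-space, $\partial\mathbb H^m$ its boundary at infinity, $\overline{\mathbb H}^m=\mathbb H^m\cup\partial\mathbb H^m$; $\|\cdot\|$ is the total mass of a measure. A subgroup of $\mathrm{Isom}(\mathbb H^m)$ is non-elementary if every non-empty subset of $\partial\mathbb H^m$ invariant under it contains at least three points. $O$ is a fixed base-point of $\mathbb H^k$; $\delta(\Gamma)=\inf\{s>0:\sum_{\gamma\in\Gamma}e^{-sd(x,\gamma x)}<\infty\}$ (independent of $x\in\mathbb H^k$). $B_K(x,\theta)=\lim_{t\to\infty}(d(x,\gamma_\theta(t))-t)$ is the Busemann function, $\gamma_\theta$ being the unit speed geodesic ray from $O$ to $\theta\in\partial\mathbb H^k$. Patterson-Sullivan measures: $\{\mu_x\}_{x\in\mathbb H^k}$ is the family of Patterson-Sullivan measures of $\Gamma$, i.e. positive Borel measures of finite non-zero mass, concentrated on $\partial\mathbb H^k$ (in fact on the limit set of $\Gamma$), all in the same measure class, with $\|\mu_O\|=1$, $d\mu_x(\theta)=e^{-\delta(\Gamma)B_K(x,\theta)}d\mu_O(\theta)$ and $\mu_{\gamma x}=\gamma_*\mu_x$ for all $x\in\mathbb H^k,\gamma\in\Gamma$. If $\sum_{\gamma}e^{-sd(O,\gamma O)}\to\infty$ as $s\to\delta(\Gamma)^+$, $\mu_x$ is the weak limit on $\overline{\mathbb H}^k$, as $s\to\delta(\Gamma)^+$, of $\mu_x^s=\frac1{c(s)}\sum_{\gamma\in\Gamma}e^{-sd(x,\gamma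 O)}\delta_{\gamma O}$, $c(s)=\sum_{\gamma\in\Gamma}e^{-sd(O,\gamma O)}$; otherwise it is given by Patterson's standard modification of this construction. *)

(* Defs.v *)
From HB Require Import structures.
From mathcomp Require Import all_boot all_order all_algebra.
From mathcomp Require Import all_classical all_reals all_analysis.

Set Implicit Arguments.
Unset Strict Implicit.
Unset Printing Implicit Defensive.

Import Order.TTheory GRing.Theory Num.Theory.
Import numFieldNormedType.Exports.

Local Open Scope classical_set_scope.
Local Open Scope ring_scope.

Definition borel (T : ptopologicalType) := g_sigma_algebraType (@open T).

Section sum_dirac.
Context d (T : measurableType d) (R : realType) (I : choiceType).
Variables (D : set I) (w : I -> {nonneg R}) (p : I -> T).
Local Open Scope ereal_scope.

Definition sum_dirac (A : set T) : \bar R :=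
  \esum_(i in D) ((w i)%:num%:E * \d_(p i) A).

Let sum_dirac0 : sum_dirac set0 = 0.
Proof. by rewrite /sum_dirac esum1// => i _; rewrite measure0 mule0. Qed.

Let sum_dirac_ge0 A : 0 <= sum_dirac A.
Proof. by apply: esum_ge0 => i _; rewrite mule_ge0// lee_fin. Qed.

Let sum_dirac_sigma_additive : semi_sigma_additive sum_dirac.
Proof.
move=> F mF tF mUF.
pose a i n : \bar R := (w i)%:num%:E * \d_(p i) (F n).
have a0 i n : 0 <= a i n by rewrite mule_ge0// lee_fin.
have -> : sum_dirac (\bigcup_n F n) = \sum_(n <oo) sum_dirac (F n).
  rewrite nneseries_esumT; last by move=> n; exact: sum_dirac_ge0.
  transitivity (\esum_(i in D) \esum_(n in setT) a i n).
    apply: eq_esum => i Di; rewrite -nneseries_esumT// nneseriesZl//.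
    by rewrite measure_semi_bigcup.
  rewrite !esum_esum//.
  rewrite (reindex_esum (setT `*`` (fun=> D)) _ (fun x => (x.2, x.1)))//.
  split=> [[n i] []//|[n i] [n' i'] _ _ [-> ->]//|[i n] [/= Di _]].
  by exists (n, i).
  by move=> n i _ _; exact: a0.
by apply: is_cvg_nneseries => n _ _; exact: sum_dirac_ge0.
Qed.

HB.instance Definition _ := isMeasure.Build _ _ _
  sum_dirac sum_dirac0 sum_dirac_ge0 sum_dirac_sigma_additive.

End sum_dirac.

Section hyperbolic_space.
Variables (R : realType) (m : nat).

Definition sqnorm (v : 'rV[R]_m) : R := \sum_i v 0 i ^+ 2.

Definition open_ball : set 'rV[R]_m := [set v | sqnorm v < 1].
Definition unit_sphere : set 'rV[R]_m := [set v | sqnorm v = 1].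
Definition closed_ball1 : set 'rV[R]_m := [set v | sqnorm v <= 1].

Lemma closed_ball1_0 : 0 \in closed_ball1.
Proof.
by apply/mem_set; rewrite /closed_ball1/= /sqnorm big1// => i _; rewrite mxE expr0n.
Qed.

Definition hyp : Type := set_type open_ball.
Definition bdry : Type := set_type unit_sphere.
Definition hbar : Type := set_type closed_ball1.

HB.instance Definition _ := Topological.copy hyp (set_type open_ball).
HB.instance Definition _ := Topological.copy bdry (set_type unit_sphere).
HB.instance Definition _ := Topological.copy hbar (set_type closed_ball1).

Lemma hyp_hbar_subproof (x : hyp) : \val x \in closed_ball1.
Proof. by apply/mem_set/ltW; exact: (set_mem (valP x)). Qed.
Definition hyp_hbar (x : hyp) : hbar := SigSub (hyp_hbar_subproof x).

Lemma bdry_hbar_subproof (z : bdry) : \val z \in closed_ball1.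
Proof. by apply/mem_set; rewrite /closed_ball1/= (set_mem (valP z)). Qed.
Definition bdry_hbar (z : bdry) : hbar := SigSub (bdry_hbar_subproof z).

HB.instance Definition _ := isPointed.Build hbar (SigSub closed_ball1_0).

(* Distance of the Poincare ball model, of curvature -1; [hbar] with its
   Euclidean topology is the compactification of [hyp] by [bdry]. *)
Definition arcosh (u : R) : R := ln (u + Num.sqrt (u ^+ 2 - 1)).

Definition hdist (x y : hyp) : R :=
  arcosh (1 + 2 * sqnorm (\val x - \val y) /
              ((1 - sqnorm (\val x)) * (1 - sqnorm (\val y)))).

Definition geodesic_ray (x : hyp) (z : bdry) (c : R -> hyp) : Prop :=
  [/\ c 0 = x,
      forall s t, 0 <= s -> 0 <= t -> hdist (c s) (c t) = `|s - t| &
      hyp_hbar (c t) @[t --> +oo] --> bdry_hbar z].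

(* The ray is unique up to its values at negative times, which are irrelevant. *)
Definition ray (x : hyp) (z : bdry) : R -> hyp :=
  xget (cst x) [set c | geodesic_ray x z c].

Definition busemann (O x : hyp) (z : bdry) : R :=
  lim (hdist x (ray O z t) - t @[t --> +oo]).

Record isom := Isom {
  isom_fun :> hyp -> hyp;
  isom_inv : hyp -> hyp;
  isom_funK : cancel isom_fun isom_inv;
  isom_invK : cancel isom_inv isom_fun;
  isom_dist : forall x y, hdist (isom_fun x) (isom_fun y) = hdist x y }.

Lemma isom_eq (g h : isom) : isom_fun g =1 isom_fun h -> g = h.
Proof.
case: g h => [f f' fK f'K fd] [g g' gK g'K gd]/= /funext fg.
move: fK f'K fd; rewrite {f}fg => fK f'K fd.
have fg' : f' = g' by apply/funext => x; rewrite -[x in LHS]g'K fK.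
move: fK f'K; rewrite {f'}fg' => fK f'K.
by congr Isom; exact: Prop_irrelevance.
Qed.

Definition isom1 : isom :=
  @Isom id id (fun=> erefl) (fun=> erefl) (fun _ _ => erefl).

Lemma isom_mul_dist (g h : isom) (x y : hyp) :
  hdist ((g \o h) x) ((g \o h) y) = hdist x y.
Proof. by rewrite /= !isom_dist. Qed.

Definition isom_mul (g h : isom) : isom :=
  Isom (can_comp (isom_funK g) (isom_funK h))
       (can_comp (isom_invK h) (isom_invK g)) (isom_mul_dist g h).

Lemma isom_inv_dist (g : isom) (x y : hyp) :
  hdist (isom_inv g x) (isom_inv g y) = hdist x y.
Proof. by rewrite -(isom_dist g) !isom_invK. Qed.

Definition isom_Vg (g : isom) : isom :=
  Isom (isom_invK g) (isom_funK g) (isom_inv_dist g).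

HB.instance Definition _ := gen_eqMixin isom.
HB.instance Definition _ := gen_choiceMixin isom.

Lemma isom_mulA : associative isom_mul.
Proof. by move=> f g h; exact: isom_eq. Qed.
Lemma isom_mul1g : left_id isom1 isom_mul.
Proof. by move=> f; exact: isom_eq. Qed.
Lemma isom_mulg1 : right_id isom1 isom_mul.
Proof. by move=> f; exact: isom_eq. Qed.
Lemma isom_mulVg : left_inverse isom1 isom_Vg isom_mul.
Proof. by move=> f; apply: isom_eq => x /=; rewrite isom_funK. Qed.
Lemma isom_mulgV : right_inverse isom1 isom_Vg isom_mul.
Proof. by move=> f; apply: isom_eq => x /=; rewrite isom_invK. Qed.

HB.instance Definition _ := isGroup.Build isom
  isom_mulA isom_mul1g isom_mulg1 isom_mulVg isom_mulgV.

HB.instance Definition _ := Topological.copy isom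
  (initial_topology (isom_fun : isom -> {compact-open, hyp -> hyp})).

(* The action on the boundary: the value at [z] of the (unique) continuous
   extension of [g] to the closed ball. *)
Definition bdry_act (g : isom) (z : bdry) : bdry :=
  xget z [set w | exists G : hbar -> hbar,
    [/\ continuous G, forall x, G (hyp_hbar x) = hyp_hbar (g x) &
        G (bdry_hbar z) = bdry_hbar w]].

Definition discrete_group (Gamma : set isom) : Prop :=
  Gamma `<=` isolated Gamma.

Definition nonelementary (Gamma : set isom) : Prop :=
  forall S : set bdry, S !=set0 ->
    (forall g, Gamma g -> bdry_act g @` S = S) -> (`I_3 #<= S)%card.

Definition limit_set (Gamma : set isom) (O : hyp) : set bdry :=
  [set z | closure [set hyp_hbar (g O) | g in Gamma] (bdry_hbar z)].

End hyperbolic_space.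

Lemma unit_sphere_delta (R : realType) (m : nat) :
  delta_mx 0 0 \in @unit_sphere R m.+1.
Proof.
apply/mem_set; rewrite /unit_sphere/= /sqnorm (bigD1 ord0)//= big1.
  by rewrite mxE !eqxx expr1n addr0.
by move=> i /negbTE i0; rewrite mxE i0 andbF expr0n.
Qed.

(* Measurable types are pointed in the library, so measures on the boundary are
   only available in dimension [m.+1]; in dimension 0 the boundary is empty. *)
HB.instance Definition _ (R : realType) (m : nat) :=
  isPointed.Build (bdry R m.+1) (SigSub (unit_sphere_delta R m)).

Section patterson_sullivan.
Variables (R : realType) (m : nat).
Notation H := (hyp R m.+1).
Notation dH := (bdry R m.+1).
Notation Hbar := (hbar R m.+1).
Implicit Types (Gamma : set (isom R m.+1)) (O x y : H) (s : R).

(* With [h = 1] this is the Poincare series; other choices of [h] give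
   Patterson's modified series. *)
Definition poincare_term (h : R -> {posnum R}) x y s : R :=
  (h (expR (hdist x y)))%:num * expR (- s * hdist x y).

Lemma poincare_term_ge0 h x y s : 0 <= poincare_term h x y s.
Proof. by rewrite mulr_ge0// expR_ge0. Qed.

Definition poincare_series Gamma (h : R -> {posnum R}) x y s : \bar R :=
  \esum_(g in Gamma) (poincare_term h x (g y) s)%:E.

Definition no_modif : R -> {posnum R} := cst 1%:pos.

Definition critical_exponent Gamma x : R :=
  inf [set s | 0 < s /\ (poincare_series Gamma no_modif x x s < +oo)%E].

Lemma poincare_series_fine_ge0 Gamma h x y s :
  0 <= (fine (poincare_series Gamma h x y s))^-1.
Proof. by rewrite invr_ge0 fine_ge0// esum_ge0// => g _; rewrite lee_fin poincare_term_ge0. Qed.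

Definition patterson_approx Gamma h O x s :
    {measure set (borel Hbar) -> \bar R} :=
  mscale (NngNum (poincare_series_fine_ge0 Gamma h O O s))
    (sum_dirac Gamma (fun g => NngNum (poincare_term_ge0 h x (g O) s))
       (fun g => hyp_hbar (g O) : borel Hbar)).

(* [mu] lives on the boundary; the limit is taken on the closed ball. *)
Definition weak_lim (I : Type) (F : set_system I)
    (nu : I -> {measure set (borel Hbar) -> \bar R})
    (mu : {measure set (borel dH) -> \bar R}) : Prop :=
  forall phi : Hbar -> R, continuous phi ->
    (\int[nu i]_y (phi y)%:E)%E @[i --> F] --> (\int[mu]_z (phi (bdry_hbar z))%:E)%E.

(* The auxiliary functions of Patterson's lemma (Acta Math. 136, 1976): [h] is
   slowly varying and makes the modified series diverge at the exponent. *)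
Definition patterson_function Gamma O (h : R -> {posnum R}) : Prop :=
  let delta := critical_exponent Gamma O in
  [/\ forall r r', 0 < r -> r <= r' -> (h r)%:num <= (h r')%:num,
      forall s, delta < s -> (poincare_series Gamma h O O s < +oo)%E,
      forall s, s <= delta -> poincare_series Gamma h O O s = +oo%E &
      forall e, 0 < e -> exists2 r0 : R, 0 < r0 &
        forall r t, r0 <= r -> 1 <= t ->
          (h (t * r))%:num <= t `^ e * (h r)%:num].

Definition patterson_construction Gamma O
    (mu : H -> {finite_measure set (borel dH) -> \bar R}) : Prop :=
  let delta := critical_exponent Gamma O in
  let divergent :=
    poincare_series Gamma no_modif O O s @[s --> delta^'+] --> +oo%E in
  (divergent -> forall x,
     weak_lim delta^'+ (patterson_approx Gamma no_modif O x) (mu x)) /\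
  (~ divergent -> exists2 h, patterson_function Gamma O h &
     exists s_ : nat -> R, [/\ forall j, delta < s_ j,
       s_ j @[j --> \oo] --> delta &
       forall x, weak_lim \oo (fun j => patterson_approx Gamma h O x (s_ j))
                          (mu x)]).

Definition patterson_sullivan Gamma O
    (mu : H -> {finite_measure set (borel dH) -> \bar R}) : Prop :=
  let delta := critical_exponent Gamma O in
  [/\ forall x, (0 < mu x setT)%E,
      forall x, mu x (~` limit_set Gamma O) = 0%E,
      forall x y, mu x `<< mu y,
      mu O setT = 1%E &
   [/\ forall x A, measurable A ->
        mu x A = (\int[mu O]_(z in A) (expR (- delta * busemann O x z))%:E)%E,
      forall x g A, Gamma g -> measurable A ->
        mu (g x) A = pushforward (mu x) (bdry_act g : borel dH -> borel dH) A &
      patterson_construction Gamma O mu]].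

End patterson_sullivan.

Definition developing_measures (R : realType) (k n : nat) (O : hyp R k.+1)
    (Gamma : set (isom R k.+1)) (rho : isom R k.+1 -> isom R n.+1)
    (mu : hyp R k.+1 -> {finite_measure set (borel (bdry R k.+1)) -> \bar R})
    (lambda : bdry R k.+1 ->
       {finite_measure set (borel (bdry R n.+1)) -> \bar R}) : Prop :=
  [/\ {ae mu O, forall z, forall g, Gamma g -> forall A, measurable A ->
         lambda (bdry_act g z) A =
         pushforward (lambda z)
           (bdry_act (rho g) : borel (bdry R n.+1) -> borel (bdry R n.+1)) A},
      forall phi : bdry R n.+1 -> R, continuous phi ->
        (mu O).-integrable setT (fun z => \int[lambda z]_w (phi w)%:E)%E,
      (fun z => fine (lambda z setT)) \in Lfun (mu O) +oo%E &
      {ae mu O, forall z, (0 < lambda z setT)%E}].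

(* Main.v *)
Require Import Defs.
From HB Require Import structures.
From mathcomp Require Import all_boot all_order all_algebra.
From mathcomp Require Import all_classical all_reals all_analysis.
From mathcomp Require Import measurable_realfun ess_sup_inf.
From mathcomp Require Import ring lra.

Set Implicit Arguments.
Unset Strict Implicit.
Unset Printing Implicit Defensive.

Import Order.TTheory GRing.Theory Num.Theory.
Import numFieldNormedType.Exports.

Local Open Scope classical_set_scope.
Local Open Scope ring_scope.

(** The developing measures are the conditional measures of a limit of averages
    over the group. Average over [Gamma] with the (modified) weights of
    the Poincare series at the exponent [s], and let [s] tend to the critical
    exponent [delta] along an ultrafilter. The result is a mean, that is a
    positive linear functional [m] on the bounded functions on [Gamma], with
    two properties ([patterson_mean]).

    - For [phi] continuous on the closed ball, [m (phi (g O))] is the integral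
      of [phi] for the Patterson measure at [O], since the latter is the
      weak limit of the same averages.
    - [m] is quasi-invariant: [m (F (g _))] is [m] of [F] times
      [expR (delta * (d(O, _) - d(g O, _)))]. Here the difference of distances
      extends continuously to the closed ball ([dist_diff]), and the
      modification of the series is so slowly varying that it cancels at
      infinity ([poincare_ratio_cvg]).

    Fix a point [w0] of the boundary of the target space. Then
    [F, phi |-> m (F (g O) * phi (rho g w0))] plays the part of a joint law
    of [g O] and [rho g w0], the limit of the measures
    [sum_g weight(g) dirac (g O, rho g w0)]. Its first marginal is the Patterson
    measure, so it disintegrates into probability measures [lambda_z] on
    the second factor ([mean_disintegration]). The quasi-invariance of [m],
    applied to the marginal and to the joint law, shows that
    [lambda_(g z)] and the image of [lambda_z] under [rho g] give a test
    function the same integral for almost every [z]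
    ([disintegration_equivariant]). Since [Gamma] is countable and countably
    many test functions determine a measure ([tests_separate_measures]), the
    exceptional null set can be taken independent of both. The total mass of
    [lambda_z] is 1, which gives the bounds on the mass.

    The disintegration is made explicit by writing the compact spaces as images
    of the Cantor set. A measure there is an additive function of finite
    words ([tree_measure]), and the conditional measures are obtained from
    a Radon-Nikodym density for each of the countably many words, corrected so
    that additivity holds at every point ([split_density]).

    The boundary action enters through the chord identity [isom_chord]: it
    makes an isometry of the ball a rational function of the Euclidean
    coordinates, with a denominator that does not vanish on the closed ball.
    Hence isometries extend continuously, and the action on the boundary is
    continuous and multiplicative. *)

(** * Digits in the Cantor set *)

Section cantor_words.
Implicit Types (a : seq bool) (x : cantor_space) (j : nat).

(** The first [j] digits, most recent first, so that descending in the tree of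
    words is [cons]. *)
Definition word x j : seq bool := rev (mkseq x j).

Definition word_point a : cantor_space := nth false (rev a).

Lemma size_word x j : size (word x j) = j.
Proof. by rewrite size_rev size_mkseq. Qed.

Lemma wordS x j : word x j.+1 = x j :: word x j.
Proof. by rewrite /word mkseqS rev_rcons. Qed.

Lemma word_pointK a : word (word_point a) (size a) = a.
Proof. by rewrite /word /word_point -size_rev mkseq_nth revK. Qed.

Lemma eq_wordP x y j :
  word x j = word y j <-> forall i, (i < j)%N -> x i = y i.
Proof.
split=> [/(can_inj revK)/(congr1 (nth false)) xy i ij|xy].
  by have := congr1 (@^~ i) xy; rewrite /= !nth_mkseq.
congr rev; apply/eq_in_map => i; rewrite mem_iota => ij; exact: xy.
Qed.

Lemma word_continuous x j : \forall y \near x, word y j = word x j.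
Proof.
elim: j => [|j IH]; first by near=> y.
have xj : \forall y \near x, y j = x j.
  have /(_ x [set x j]) := @proj_continuous nat (fun=> bool) j.
  by apply; exact: discrete_set1.
by near=> y; rewrite !wordS; congr cons; near: y.
Unshelve. all: end_near. Qed.

(** The sets of sequences with given first digits form a filter basis, which is
    finer than the product topology because it is so on each coordinate. *)
Lemma cantor_nbhs x (V : set cantor_space) : nbhs x V ->
  exists j, forall y, word y j = word x j -> V y.
Proof.
pose G : set_system cantor_space :=
  filter_from setT (fun j => [set y | word y j = word x j]).
have FG : Filter G.
  apply: filter_from_filter; first by exists 0%N.
  move=> i j _ _; exists (maxn i j) => // y /= /eq_wordP xy.
  by split; apply/eq_wordP => l li; apply: xy; rewrite leq_max li ?orbT.
have Gx : G --> x.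
  apply/cvg_sup => i U [_ [[W oW <-] Wx] WU].
  exists i.+1 => // y /= /eq_wordP/(_ i (ltnSn i)) yx; apply: WU.
  by rewrite /preimage/= yx.
by move=> /Gx[j _ jV]; exists j => y /jV.
Qed.

(** Continuous functions on the Cantor set are uniformly close to functions of
    finitely many digits, by compactness. *)
Lemma cantor_approx (R : realType) (f : cantor_space -> R) :
  continuous f -> forall e, 0 < e -> \forall j \near \oo,
  forall x, `|f x - f (word_point (word x j))| <= e.
Proof.
move=> cf e e0.
have /compact_near_coveringP := cantor_space_compact.
move=> /(_ nat \oo (fun j x => `|f x - f (word_point (word x j))| <= e) _).
suff H : forall x, [set: cantor_space] x -> \forall x' \near x & i \near \oo,
    `|f x' - f (word_point (word x' i))| <= e.
  move=> /(_ H); apply: filterS => j jH x; exact: (jH x I).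
move=> x _.
have /cvgrPdist_lt /(_ (e / 2)) := cf x.
rewrite divr_gt0// => /(_ isT) /cantor_nbhs[j xj].
exists ([set y | word y j = word x j], [set i | (j <= i)%N]).
  by split; [exact: word_continuous|exists j].
move=> [y i]/= [yx ji].
have w : word (word_point (word y i)) j = word x j.
  rewrite -yx; apply/eq_wordP => l lj; have := leq_trans lj ji.
  by move: l {lj}; apply/eq_wordP;
    rewrite -[X in word _ X = _](size_word y i) word_pointK.
rewrite (le_trans (ler_distD (f x) _ _))// [leRHS]splitr lerD//.
  by rewrite distrC ltW// xj.
by rewrite ltW// xj.
Qed.

End cantor_words.

(** * Bounded functions and finite measures *)

Section finite_measures.
Context d (T : measurableType d) (R : realType).

Lemma finite_measure_of (mu : {measure set T -> \bar R}) : (mu setT < +oo)%E ->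
  exists nu : {finite_measure set T -> \bar R},
    Measure.sort nu = Measure.sort mu.
Proof.
move=> muoo.
have fin : fin_num_fun (mu : set T -> \bar R).
  move=> A mA; rewrite ge0_fin_numE//; apply: le_lt_trans muoo.
  by rewrite le_measure// inE.
have sf : sigma_finite setT (mu : set T -> \bar R).
  by apply: fin_num_fun_sigma_finite; rewrite ?measure0.
pose H1 := @isFinite.Build _ T R (Measure.sort mu) fin.
pose H2 := @isSFinite.Build _ T R (Measure.sort mu)
  (sfinite_measure_sigma_finite sf).
pose H3 := @isSigmaFinite.Build _ T R (Measure.sort mu) sf.
pose nu := HB.pack_for (FiniteMeasure.type T R) (Measure.sort mu) H1 H2 H3.
by exists nu.
Qed.

Lemma bounded_integrable (mu : {measure set T -> \bar R}) (f : T -> R) (B : R) :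
  (mu setT < +oo)%E -> measurable_fun setT f -> (forall x, `|f x| <= B) ->
  mu.-integrable setT (EFin \o f).
Proof.
move=> muoo mf fB.
apply: measurable_bounded_integrable => //; exists B; split.
  exact: num_real.
by move=> M BM x _ /=; rewrite (le_trans (fB x))// ltW.
Qed.

End finite_measures.

Lemma continuous_borel (T U : ptopologicalType) (f : T -> U) : continuous f ->
  measurable_fun setT (f : borel T -> borel U).
Proof.
move=> cf; apply: (@measurability _ _ (borel T) (borel U) _ _ open) => //.
move=> _ [V oV <-]; rewrite setTI; apply: sub_sigma_algebra.
by move/continuousP : cf; apply.
Qed.

Lemma continuous_borelR (R : realType) (T : ptopologicalType) (f : T -> R) :
  continuous f -> measurable_fun setT (f : borel T -> R).
Proof.
move=> cf; apply: (measurability _ (RGenOInfty.measurableE R)).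
move=> _ [_ [x ->] <-]; rewrite setTI; apply: sub_sigma_algebra.
by move/continuousP : cf; apply.
Qed.

Section bounded_integrals.
Context d (T : measurableType d) (R : realType).
Variable mu : {measure set T -> \bar R}.
Hypothesis muoo : (mu setT < +oo)%E.

Lemma Rintegral_sum (I : Type) (s : seq I) (f : I -> T -> R) :
  (forall i, mu.-integrable setT (EFin \o f i)) ->
  \int[mu]_x (\sum_(i <- s) f i x) = \sum_(i <- s) \int[mu]_x f i x.
Proof.
move=> fi; elim: s => [|i s IH].
  rewrite big_nil (_ : (fun _ => _) = cst 0) ?Rintegral_cst ?mul0r//.
  by apply/funext => x; rewrite big_nil.
rewrite big_cons -IH -RintegralD//.
  by congr Rintegral; apply/funext => x; rewrite big_cons.
rewrite (_ : _ \o _ = fun x => (\sum_(j <- s) (EFin \o f j) x)%E).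
  exact: integrable_sum.
by apply/funext => x /=; rewrite sumEFin.
Qed.

Lemma bounded_cvg_Rintegral (g_ : nat -> T -> R) (g : T -> R) (B : R) :
  (forall n, measurable_fun setT (g_ n)) ->
  (forall n x, `|g_ n x| <= B) -> (forall x, g_ n x @[n --> \oo] --> g x) ->
  \int[mu]_x g_ n x @[n --> \oo] --> \int[mu]_x g x.
Proof.
move=> mg_ gB gc.
have mg : measurable_fun setT g.
  by apply: (measurable_fun_cvg mg_) => x _; exact: gc.
have [|||||ig _ H] := @dominated_convergence _ T R mu setT measurableT
  (fun n => EFin \o g_ n) (EFin \o g) (EFin \o cst B).
- by move=> n; exact/measurable_EFinP.
- exact/measurable_EFinP.
- by apply: aeW => x _ /=; apply: cvg_EFin; [exact: nearW|exact: gc].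
- by apply: (@bounded_integrable _ _ _ _ (cst B) `|B|).
- by apply: aeW => x n _ /=; rewrite lee_fin gB.
apply: fine_cvg; rewrite fineK//; exact: integrable_fin_num.
Qed.

Lemma normr_Rintegral_le (f : T -> R) (B : R) : measurable_fun setT f ->
  (forall x, `|f x| <= B) -> `|\int[mu]_x f x| <= B * fine (mu setT).
Proof.
move=> mf fB; have fi := bounded_integrable muoo mf fB.
apply: (le_trans (le_normr_Rintegral measurableT fi)).
have -> : B * fine (mu setT) = \int[mu]_x cst B x by rewrite Rintegral_cst.
apply: le_Rintegral => //.
- apply: (bounded_integrable muoo (B := B)) => [|x].
    exact: measurableT_comp.
  by rewrite normr_id.
- by apply: (bounded_integrable muoo (B := `|B|)).
Qed.

End bounded_integrals.

Lemma finite_pushforward d d' (T : measurableType d) (U : measurableType d')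
    (R : realType) (mu : {measure set T -> \bar R}) (f : T -> U) :
  (mu setT < +oo)%E -> measurable_fun setT f ->
  exists nu : {finite_measure set U -> \bar R},
    (forall A, nu A = mu (f @^-1` A)) /\
    forall (g : U -> R) (B : R), measurable_fun setT g ->
      (forall y, `|g y| <= B) -> \int[nu]_y g y = \int[mu]_x g (f x).
Proof.
move=> muoo mf.
have [nu nuE] := @finite_measure_of _ _ _
  (measure_function_pushforward__canonical__measure_function_Measure mu mf) muoo.
exists nu; split; first by move=> A; rewrite nuE.
move=> g B mg gB; rewrite /Rintegral nuE integral_pushforward//.
  exact/measurable_EFinP.
apply: (@bounded_integrable _ _ _ _ (g \o f) B) => //.
  exact: measurableT_comp.
by move=> x; exact: gB.
Qed.

(** * Measures from additive functions of words *)

Section tree_measure.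
Context (R : realType) (p : seq bool -> R).
Hypothesis p_ge0 : forall a, 0 <= p a.
Hypothesis p_add : forall a, p (false :: a) + p (true :: a) = p a.
Implicit Types (a : seq bool) (t : R).

(** The left end of the interval of length [p a] attached to the word [a]: the
    interval of [a] is cut into those of [false :: a] and [true :: a], in this
    order, starting with the interval from 0 to [p nil]. *)
Fixpoint start a : R :=
  if a is b :: a' then start a' + (if b then p (false :: a') else 0) else 0.

(** The word of length [j] whose interval contains [t]. *)
Fixpoint branch t j : seq bool :=
  if j is j'.+1 then (start (true :: branch t j') <= t) :: branch t j' else [::].

Definition path_of t : cantor_space := fun j => start (true :: branch t j) <= t.

Lemma word_path t j : word (path_of t) j = branch t j.
Proof. by elim: j => // j IH; rewrite wordS IH. Qed.

Lemma size_branch t j : size (branch t j) = j.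
Proof. by rewrite -word_path size_word. Qed.

Lemma branch_itvP a t : 0 <= t < p [::] ->
  (branch t (size a) = a) <-> (start a <= t < start a + p a).
Proof.
move=> tp; elim: a => [|b a [IH1 IH2]]; first by rewrite /= add0r.
split=> /=.
  move=> [E1 E2]; move: E1; rewrite E2 => E1.
  have /andP[at1 at2] := IH1 E2.
  by move: E1 (p_add a); case: b => /= E1 pa;
    [|move/negbT: E1; rewrite -ltNge => E1]; apply/andP; split; lra.
move=> /andP[at1 at2].
have E : branch t (size a) = a.
  apply: IH2; have := p_add a; have := p_ge0 (true :: a).
  have := p_ge0 (false :: a).
  by move: at1 at2; case: b => at1 at2 *; apply/andP; split; lra.
rewrite E; congr cons.
move: at1 at2; case: b; first by move=> ->.
by move=> _ at2; apply/negbTE; rewrite -ltNge; move: at2; lra.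
Qed.

Lemma measurable_branch a : measurable [set t | branch t (size a) = a].
Proof.
elim: a => [|b a IH]; first by rewrite [X in measurable X](_ : _ = setT)//;
  apply/seteqP; split.
have mE : measurable [set t | start (true :: a) <= t].
  rewrite [X in measurable X](_ : _ = `[start (true :: a), +oo[%classic)//.
  by apply/seteqP; split=> t /=; rewrite in_itv/= andbT.
rewrite [X in measurable X](_ : _ = [set t | branch t (size a) = a] `&`
   (if b then [set t | start (true :: a) <= t]
    else ~` [set t | start (true :: a) <= t])).
  by apply: measurableI => //; case: b => //; exact: measurableC.
apply/seteqP; split=> t /=.
  by move=> [E1 E2]; split=> //; move: E1; rewrite E2; case: b => // /negbT/negP.
move=> [E1]; rewrite E1; case: b => [->//|/negP/negbTE].
by move=> /= ->.
Qed.

Lemma lebesgue_branch a :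
  lebesgue_measure (`[0, p [::][ `&` [set t | branch t (size a) = a]) = (p a)%:E.
Proof.
have inc c : 0 <= start c /\ start c + p c <= p [::].
  elim: c => [|b c [IH1 IH2]] /=; first by rewrite add0r.
  have := p_add c; have := p_ge0 (true :: c); have := p_ge0 (false :: c).
  by case: b => *; split; lra.
have [i1 i2] := inc a.
rewrite (_ : _ `&` _ = `[start a, start a + p a[%classic).
  rewrite lebesgue_measure_itv/= lte_fin ltrDl; case: ifPn.
    by rewrite -EFinB addrAC subrr add0r.
  by rewrite -leNgt => pa; congr EFin; apply/eqP; rewrite eq_le p_ge0 pa.
apply/seteqP; split=> t /=.
  by rewrite in_itv/= => -[tp /(branch_itvP _ tp)]; rewrite in_itv.
rewrite !in_itv/= => tI.
have tp : 0 <= t < p [::] by case/andP : tI => *; apply/andP; split; lra.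
by split=> //; apply/branch_itvP.
Qed.

(** An open set of the image pulls back to the union of the intervals of
    the words all of whose continuations are mapped into it. *)
Lemma measurable_path (T : ptopologicalType) (f : cantor_space -> T) :
  continuous f -> measurable_fun setT (f \o path_of : R -> borel T).
Proof.
move=> cf; apply: (@measurability _ _ R (borel T) _ _ open) => //.
move=> _ [V oV <-]; rewrite setTI.
rewrite [X in measurable X](_ : _ = \bigcup_(a in [set a |
    forall x, word x (size a) = a -> V (f x)]) [set t | branch t (size a) = a]).
  rewrite bigcup_mkcond; apply: countable_bigcupT_measurable => // a.
  by case: ifPn => // _; exact: measurable_branch.
apply/seteqP; split=> t /=.
  move=> Vt; have /cantor_nbhs[j jV] : nbhs (path_of t) (f @^-1` V).
    by apply: cf; exact: open_nbhs_nbhs.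
  exists (branch t j) => /=; last by rewrite size_branch.
  by move=> x; rewrite size_branch -word_path => /jV.
by move=> [a /= aV ta]; apply: aV; rewrite word_path.
Qed.

End tree_measure.

Lemma sum_words (R : pzRingType) (c : seq bool -> R) (w : seq bool) j :
  size w = j -> \sum_(a : j.-tuple bool) c a * (w == a)%:R = c w.
Proof.
move=> <-; rewrite (bigD1 (in_tuple w))//= eqxx mulr1 big1 ?addr0// => a.
by rewrite -val_eqE/= eq_sym => /negbTE ->; rewrite mulr0.
Qed.

(** Every additive function of words comes from a measure: lay the words out as
    nested intervals of the real line, and push Lebesgue measure forward along
    the path that reads off the digits of a point. Integrals are limits of sums
    over words by [cantor_approx]; the bound on the sums, uniform in [j], is
    what dominated convergence in a parameter of [p] requires. *)
Lemma tree_measure (R : realType) (T : ptopologicalType)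
    (f : cantor_space -> T) (p : seq bool -> R) :
  continuous f -> (forall a, 0 <= p a) ->
  (forall a, p (false :: a) + p (true :: a) = p a) ->
  exists nu : {finite_measure set (borel T) -> \bar R},
    nu setT = (p [::])%:E /\
    forall phi : T -> R, continuous phi -> forall B, (forall x, `|phi x| <= B) ->
    (forall j, `|\sum_(a : j.-tuple bool) phi (f (word_point a)) * p a|
      <= B * p [::]) /\
    \sum_(a : j.-tuple bool) phi (f (word_point a)) * p a @[j --> \oo]
      --> \int[nu]_x phi x.
Proof.
move=> cf p0 pD.
pose mu : {measure set (measurableTypeR R) -> \bar R} :=
  mrestr (@lebesgue_measure R) (measurable_itv `[0, p [::][).
have muT : mu setT = (p [::])%:E.
  have := lebesgue_branch p0 pD [::]; rewrite setIC.
  by congr (lebesgue_measure _ = _); congr (_ `&` _); apply/seteqP; split.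
have muoo : (mu setT < +oo)%E by rewrite muT ltry.
have [nu [nuE nuI]] := finite_pushforward muoo (measurable_path p cf).
exists nu; split; first by rewrite nuE preimage_setT.
move=> phi cphi B phiB.
rewrite (nuI _ B)//; last exact: continuous_borelR.
pose g j t := phi (f (word_point (branch p t j))).
have mb j (a : j.-tuple bool) :
    measurable_fun setT (fun t => (branch p t j == a)%:R : R).
  rewrite [X in measurable_fun _ X](_ : _ =
      \1_[set t | branch p t (size a) = a]).
    by apply: measurable_indic; exact: measurable_branch.
  apply/funext => t; rewrite indicE size_tuple; congr (_%:R); congr nat_of_bool.
  by apply/eqP/idP => [/mem_set//|/set_mem].
have mc j (a : j.-tuple bool) (c : R) :
    measurable_fun setT (fun t => c * (branch p t j == a)%:R : R).
  by apply: measurable_funM => //; exact: mb.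
have gE j t : g j t =
    \sum_(a : j.-tuple bool) phi (f (word_point a)) * (branch p t j == a)%:R.
  by rewrite (sum_words (fun a => phi (f (word_point a))) (size_branch p t j)).
have SE j : \sum_(a : j.-tuple bool) phi (f (word_point a)) * p a =
    \int[mu]_t g j t.
  rewrite (funext (gE j)) Rintegral_sum//; last first.
    move=> a; apply: (@bounded_integrable _ _ _ _ _ `|phi (f (word_point a))|) => //.
      exact: mc.
    by move=> t; rewrite normrM; case: (_ == _); rewrite ?normr0 ?normr1 ?mulr1 ?mulr0.
  apply: eq_bigr => a _; rewrite RintegralZl//; last first.
    apply: (@bounded_integrable _ _ _ _ _ 1) => //.
      exact: mb.
    by move=> t; case: (_ == _); rewrite ?normr0 ?normr1.
  congr (_ * _).
  rewrite /Rintegral (_ : (fun t => _) =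
      fun t => (\1_[set t | branch p t (size a) = a] t)%:E).
    rewrite integral_indic//; last exact: measurable_branch.
    by rewrite setIT /= /mrestr setIC lebesgue_branch.
  apply/funext => t; rewrite indicE size_tuple; congr ((_%:R)%:E).
  by congr nat_of_bool; apply/eqP/idP => [/mem_set//|/set_mem].
have mg j : measurable_fun setT (g j).
  by rewrite (funext (gE j)); apply: measurable_sum => a; exact: mc.
have gB j t : `|g j t| <= B by exact: phiB.
split=> [j|].
  rewrite SE; apply: (le_trans (normr_Rintegral_le muoo (mg j) (gB j))).
  by rewrite muT.
rewrite (funext SE).
apply: (@bounded_cvg_Rintegral _ _ _ _ muoo _ _ B) => //.
move=> t; apply/cvgrPdist_le => e e0.
have cpf : continuous (phi \o f).
  by move=> x; apply: continuous_comp; [exact: cf|exact: cphi].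
have := cantor_approx cpf e0; apply: filterS => j /(_ (path_of p t)).
by rewrite word_path.
Qed.

(** * Means on bounded functions *)

Definition bnd (R : realType) (I : Type) (F : I -> R) :=
  exists B, forall i, `|F i| <= B.

Section bnd.
Context (R : realType) (I : Type).
Implicit Types (F G : I -> R) (c : R).

Lemma bnd_cst c : bnd (fun _ : I => c).
Proof. by exists `|c|. Qed.

Lemma bndD F G : bnd F -> bnd G -> bnd (fun i => F i + G i).
Proof.
by move=> [B FB] [C GC]; exists (B + C) => i;
  rewrite (le_trans (ler_normD _ _))// lerD.
Qed.

Lemma bndM F G : bnd F -> bnd G -> bnd (fun i => F i * G i).
Proof. by move=> [B FB] [C GC]; exists (B * C) => i; rewrite normrM ler_pM. Qed.

Lemma bndN F : bnd F -> bnd (fun i => - F i).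
Proof. by move=> [B FB]; exists B => i; rewrite normrN. Qed.

Lemma bnd_norm F : bnd F -> bnd (fun i => `|F i|).
Proof. by move=> [B FB]; exists B => i; rewrite normr_id. Qed.

Lemma bnd_bool (P : I -> bool) : bnd (fun i => (P i)%:R : R).
Proof. by exists 1 => i; case: (P i); rewrite ?normr0 ?normr1. Qed.

Lemma bnd_sum (J : Type) (s : seq J) (F : J -> I -> R) :
  (forall j, bnd (F j)) -> bnd (fun i => \sum_(j <- s) F j i).
Proof.
move=> bF; elim: s => [|j s IH].
  by under eq_fun do rewrite big_nil; exact: bnd_cst.
by under eq_fun do rewrite big_cons; exact: bndD.
Qed.

Lemma bnd_comp (J : Type) F (g : J -> I) : bnd F -> bnd (fun j => F (g j)).
Proof. by move=> [B FB]; exists B => j. Qed.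

End bnd.

(** Finitely additive integrals of bounded functions on a set. Such an [m] is
    defined at all functions, but only its values at bounded ones matter. *)
Record is_mean (R : realType) (I : Type) (m : (I -> R) -> R) : Prop := IsMean {
  meanD : forall F G, bnd F -> bnd G -> m (fun i => F i + G i) = m F + m G;
  meanZ : forall c F, bnd F -> m (fun i => c * F i) = c * m F;
  ler_mean : forall F G, bnd F -> bnd G -> (forall i, F i <= G i) -> m F <= m G
}.

Section mean_theory.
Context (R : realType) (I : Type) (m : (I -> R) -> R).
Hypothesis mm : is_mean m.
Implicit Types F G H : I -> R.

Lemma mean0 : m (fun=> 0) = 0.
Proof.
by have := meanZ mm 0 (bnd_cst I 0); under eq_fun do rewrite mul0r; rewrite mul0r.
Qed.

Lemma mean_ge0 F : bnd F -> (forall i, 0 <= F i) -> 0 <= m F.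
Proof. by move=> bF F0; rewrite -mean0; apply: ler_mean => //; exact: bnd_cst. Qed.

Lemma mean_sum (J : Type) (s : seq J) (F : J -> I -> R) :
  (forall j, bnd (F j)) ->
  m (fun i => \sum_(j <- s) F j i) = \sum_(j <- s) m (F j).
Proof.
move=> bF; elim: s => [|j s IH].
  by under eq_fun do rewrite big_nil; rewrite big_nil mean0.
under eq_fun do rewrite big_cons.
by rewrite big_cons meanD// ?IH//; exact: bnd_sum.
Qed.

Lemma meanB F G : bnd F -> bnd G -> m (fun i => F i - G i) = m F - m G.
Proof.
move=> bF bG; rewrite meanD//; last exact: bndN.
by congr (_ + _); rewrite -mulN1r -meanZ//; congr m; apply/funext => i;
  rewrite mulN1r.
Qed.

Lemma mean_dist F G H : bnd F -> bnd G -> bnd H ->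
  (forall i, `|F i - G i| <= H i) -> `|m F - m G| <= m H.
Proof.
move=> bF bG bH FG; rewrite -meanB// ler_norml -mulN1r -meanZ//.
have bFG : bnd (fun i => F i - G i) by apply: bndD => //; exact: bndN.
apply/andP; split; apply: ler_mean => //.
- exact: bndM (bnd_cst _ _) bH.
- by move=> i; have := FG i; rewrite mulN1r ler_norml => /andP[].
- by move=> i; have := FG i; rewrite ler_norml => /andP[].
Qed.

End mean_theory.

(** Every nonempty compact metrizable space is of this kind. *)
Definition cantor_image (T : topologicalType) (f : cantor_space -> T) :=
  continuous f /\ forall y, exists x, f x = y.

Lemma cantor_image_bnd (R : realType) (T : topologicalType)
    (f : cantor_space -> T) (phi : T -> R) :
  cantor_image f -> continuous phi -> bnd phi.
Proof.
move=> [cf sf] cphi.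
have : compact ((phi \o f) @` [set: cantor_space]).
  apply: continuous_compact cantor_space_compact.
  apply: continuous_subspaceT => x; apply: continuous_comp; first exact: cf.
  exact: cphi.
move=> /compact_bounded[B [_ BP]]; exists (B + 1) => y.
have [x <-] := sf y; apply: (BP (B + 1)); first by rewrite ltrDl.
by exists x.
Qed.

Section mean_words.
Context (R : realType) (I : Type) (m : (I -> R) -> R) (T : topologicalType).
Context (f : cantor_space -> T) (code : I -> cantor_space).
Hypotheses (mm : is_mean m) (fT : cantor_image f).

(** Each index has the sequence [code i]; this is the mass, with density [H], of
    the indices whose sequence begins with [a]. *)
Definition mean_word (H : I -> R) (a : seq bool) : R :=
  m (fun i => (word (code i) (size a) == a)%:R * H i).

Lemma mean_word_ge0 H a : bnd H -> (forall i, 0 <= H i) -> 0 <= mean_word H a.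
Proof.
move=> bH H0; apply: (mean_ge0 mm); first exact: bndM (bnd_bool _ _) bH.
by move=> i; rewrite mulr_ge0.
Qed.

Lemma mean_wordD H a : bnd H ->
  mean_word H (false :: a) + mean_word H (true :: a) = mean_word H a.
Proof.
move=> bH; have bb b : bnd (fun i =>
    (word (code i) (size (b :: a)) == b :: a)%:R * H i).
  exact: bndM (bnd_bool _ _) bH.
rewrite -(meanD mm)//; congr m; apply/funext => i.
rewrite -mulrDl; congr (_ * _); rewrite !wordS !eqseq_cons.
by case: (code i _); rewrite /= ?add0r ?addr0.
Qed.

Lemma mean_word_nil H : mean_word H [::] = m H.
Proof. by congr m; apply/funext => i; rewrite mul1r. Qed.

Lemma mean_word_cvg (phi : T -> R) H : continuous phi -> bnd H ->
  \sum_(a : j.-tuple bool) phi (f (word_point a)) * mean_word H a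
    @[j --> \oo] --> m (fun i => phi (f (code i)) * H i).
Proof.
move=> cphi bH; have bphi := cantor_image_bnd fT cphi.
have E j : \sum_(a : j.-tuple bool) phi (f (word_point a)) * mean_word H a =
    m (fun i => phi (f (word_point (word (code i) j))) * H i).
  transitivity (m (fun i => \sum_(a : j.-tuple bool) phi (f (word_point a)) *
      ((word (code i) j == a)%:R * H i))).
    rewrite (mean_sum mm); last first.
      by move=> a; apply: bndM (bnd_cst _ _) (bndM (bnd_bool _ _) bH).
    apply: eq_bigr => a _; rewrite -(meanZ mm); last exact: bndM (bnd_bool _ _) bH.
    by rewrite /mean_word size_tuple.
  congr m; apply/funext => i; under eq_bigr do rewrite mulrA.
  by rewrite -mulr_suml (sum_words (fun a => phi (f (word_point a))))// size_word.
rewrite (funext E); apply/cvgrPdist_le => e e0.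
have cpf : continuous (phi \o f).
  by move=> x; apply: continuous_comp; [exact: fT.1|exact: cphi].
have H1 : 0 < m (fun i => `|H i|) + 1.
  by rewrite ltr_wpDl// (mean_ge0 mm)//; exact: bnd_norm.
have := cantor_approx cpf (divr_gt0 e0 H1); apply: filterS => j jP.
apply: (@le_trans _ _ (m (fun i => e / (m (fun i => `|H i|) + 1) * `|H i|))).
  apply: (mean_dist mm); try (apply: bndM => //).
  - exact: bnd_comp bphi.
  - exact: (@bnd_comp _ _ _ phi (fun i => f (word_point (word (code i) j)))).
  - exact: bnd_cst.
  - exact: bnd_norm.
  - by move=> i; rewrite -mulrBl normrM ler_wpM2r// jP.
rewrite (meanZ mm); last exact: bnd_norm.
by rewrite mulrAC ler_pdivrMr// ler_pM2l// lerDl.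
Qed.

End mean_words.

(** A mean of continuous functions of a compact metrizable variable [q] is
    integration against a measure. Choosing preimages of the values of [q] in
    the Cantor set turns the mean into an additive function of words, and there
    is no loss of mass by compactness. *)
Lemma mean_measure (R : realType) (I : Type) (m : (I -> R) -> R)
    (T : ptopologicalType) (f : cantor_space -> T) (q : I -> T) (G : I -> R) :
  is_mean m -> cantor_image f -> bnd G -> (forall i, 0 <= G i) ->
  exists nu : {finite_measure set (borel T) -> \bar R},
    nu setT = (m G)%:E /\
    forall phi : T -> R, continuous phi ->
      \int[nu]_x phi x = m (fun i => phi (q i) * G i).
Proof.
move=> mm fT bG G0.
have [code codeE] := choice (fun i => fT.2 (q i)).
have [nu [nuT nuI]] := tree_measure fT.1
  (fun a => mean_word_ge0 code mm a bG G0) (fun a => mean_wordD code mm a bG).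
exists nu; split; first by rewrite nuT mean_word_nil.
move=> phi cphi; have [B phiB] := cantor_image_bnd fT cphi.
have [_ c1] := nuI _ cphi _ phiB.
have c2 := mean_word_cvg (code := code) mm fT cphi bG.
rewrite (cvg_unique _ c1 c2); first by congr m; apply/funext => i; rewrite codeE.
exact: Rhausdorff.
Qed.

(** * From indicators to bounded functions *)

(** Passage from generators to all bounded measurable functions, for the
    identity between integrals of [xi] with densities [D1] and [D2] against two
    measures. The densities are there since the quasi-invariance of the mean is
    an identity of this kind. *)
Section indicator_limits.
Context d (T : measurableType d) (R : realType).
Variables (mu nu : {measure set T -> \bar R}) (D1 D2 : T -> R).
Hypotheses (muoo : (mu setT < +oo)%E) (nuoo : (nu setT < +oo)%E).
Hypotheses (mD1 : measurable_fun setT D1) (mD2 : measurable_fun setT D2).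
Hypotheses (bD1 : bnd D1) (bD2 : bnd D2).

Let same (xi : T -> R) :=
  \int[mu]_x (xi x * D1 x) = \int[nu]_x (xi x * D2 x).

Lemma same_limit (g_ : nat -> T -> R) (g : T -> R) B :
  (forall n, measurable_fun setT (g_ n)) -> (forall n x, `|g_ n x| <= B) ->
  (forall x, g_ n x @[n --> \oo] --> g x) -> (forall n, same (g_ n)) -> same g.
Proof.
move=> mg gB gc sg.
have aux (ka : {measure set T -> \bar R}) (D : T -> R) : (ka setT < +oo)%E ->
    measurable_fun setT D -> bnd D ->
    \int[ka]_x (g_ n x * D x) @[n --> \oo] --> \int[ka]_x (g x * D x).
  move=> kaoo mD [C DC].
  apply: (@bounded_cvg_Rintegral _ _ _ ka kaoo _ _ (B * C)).
  - by move=> n; exact: measurable_funM.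
  - by move=> n x; rewrite normrM ler_pM.
  - by move=> x; apply: cvgMl; exact: gc.
have c1 := aux mu D1 muoo mD1 bD1; have c2 := aux nu D2 nuoo mD2 bD2.
rewrite (_ : (fun n => _) = fun n => \int[nu]_x (g_ n x * D2 x)) in c1; last first.
  by apply/funext => n; exact: sg.
exact: (cvg_unique (@Rhausdorff R) c1 c2).
Qed.

Lemma same_lin (f g : T -> R) c :
  measurable_fun setT f -> measurable_fun setT g -> bnd f -> bnd g ->
  same f -> same g -> same (fun x => f x + c * g x).
Proof.
move=> mf mg bf bg sf sg; rewrite /same.
have aux (ka : {measure set T -> \bar R}) (D : T -> R) : (ka setT < +oo)%E ->
    measurable_fun setT D -> bnd D ->
    \int[ka]_x ((f x + c * g x) * D x) =
    \int[ka]_x (f x * D x) + c * \int[ka]_x (g x * D x).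
  move=> kaoo mD bD.
  have i1 : ka.-integrable setT (EFin \o (fun x => f x * D x)).
    have [B fB] := bndM bf bD.
    by apply: (bounded_integrable kaoo _ fB); exact: measurable_funM.
  have i2 : ka.-integrable setT (EFin \o (fun x => g x * D x)).
    have [B fB] := bndM bg bD.
    by apply: (bounded_integrable kaoo _ fB); exact: measurable_funM.
  rewrite -RintegralZl// -RintegralD//.
    by congr Rintegral; apply/funext => x; rewrite mulrDl mulrA.
  have [B fB] := bndM (bnd_cst T c) (bndM bg bD).
  apply: (bounded_integrable kaoo _ fB).
  by apply: measurable_funM => //; exact: measurable_funM.
by rewrite !aux// sf sg.
Qed.

Lemma bnd_indic (A : set T) : bnd (\1_A : T -> R).
Proof. by exists 1 => x; rewrite indicE; case: (_ \in _); rewrite ?normr0 ?normr1. Qed.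

Let mindic (A : set T) : measurable A -> measurable_fun setT (\1_A : T -> R).
Proof. by move=> mA; exact: measurable_indic. Qed.

(** Dynkin's lemma: the sets whose indicators satisfy the identity are stable
    under complements and countable disjoint unions. *)
Lemma same_measurable (G : set (set T)) : @measurable _ T = <<s G >> ->
  setI_closed G -> same (cst 1) -> (forall A, G A -> same \1_A) ->
  forall A, measurable A -> same \1_A.
Proof.
move=> mG GI s1 sG A mA; rewrite mG in mA.
apply: (dynkin_induction mG GI _ _ _ _ mA (P := fun A => same \1_A)) => //.
- by rewrite indicT.
- move=> S mS sS.
  have m1 : measurable_fun setT (cst 1 : T -> R) by [].
  have := same_lin (-1) m1 (mindic mS)
    (bnd_cst T 1) (bnd_indic S) s1 sS.
  congr same; apply/funext => x; rewrite !indicE in_setC.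
  by case: (_ \in _); rewrite /= ?mulr1 ?mulr0 ?subrr ?addr0.
- move=> F mF tF sF.
  pose U n := \bigcup_(k < n) F k.
  have mU n : measurable (U n) by exact: bigcup_measurable.
  have sU n : same \1_(U n).
    elim: n => [|n IH].
      rewrite /U bigcup_mkord big_ord0 indic0 /same.
      under eq_Rintegral do rewrite mul0r.
      under [in RHS]eq_Rintegral do rewrite mul0r.
      by rewrite !Rintegral_cst ?mul0r.
    have := same_lin 1 (mindic (mU n)) (mindic (mF n))
      (bnd_indic _) (bnd_indic _) IH (sF n).
    congr same; apply/funext => x; rewrite mul1r !indicE.
    have [Ux|Ux] := boolP (x \in U n).
      rewrite (_ : x \in F n = false) ?addr0.
        rewrite mem_set//; move: Ux => /set_mem[k /= kn Fx]; exists k => //=.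
        exact: ltnW.
      apply/negbTE/negP => /set_mem Fnx; move: Ux => /set_mem[k /= kn Fkx].
      by have := tF k n I I (ex_intro _ x (conj Fkx Fnx)) => E; rewrite E ltnn in kn.
    have [Fx|Fx] := boolP (x \in F n).
      by rewrite add0r mem_set//; exists n => //=; exact: set_mem.
    rewrite addr0; case: (boolP (x \in U n.+1)) => // /set_mem[k /=].
    rewrite ltnS leq_eqVlt => /orP[/eqP-> /mem_set|kn Fkx].
      by rewrite (negbTE Fx).
    by move: Ux; rewrite mem_set//; exists k.
  apply: (@same_limit (fun n => \1_(U n)) _ 1) => //.
    by move=> n x; rewrite indicE; case: (_ \in _); rewrite ?normr0 ?normr1.
  move=> x; rewrite indicE; case: (boolP (x \in _)) => [/set_mem[k _ Fx]|Fx].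
    apply: cvg_near_cst; exists k.+1 => // n /= kn.
    by rewrite indicE mem_set//; exists k.
  apply: cvg_near_cst; apply: nearW => n; rewrite indicE.
  case: (boolP (x \in U n)) => // /set_mem[k _ Fkx].
  by move: Fx; rewrite mem_set//; exists k.
Qed.

(** The sum counts the positive integers up to [y]. *)
Lemma floor_sum (y : R) n : 0 <= y <= n%:R ->
  `|\sum_(k < n) (k.+1%:R <= y)%R%:R - y| <= 1.
Proof.
elim: n => [|n IH] /andP[y0].
  by move=> yn; rewrite big_ord0 (le_anti (introT andP (conj yn y0))) subrr normr0.
move=> yn; rewrite big_ord_recr/=; have [ny|ny] := leP y n%:R.
  rewrite (_ : (n.+1%:R <= y) = false) ?addr0 ?IH ?y0//.
  by apply/negbTE; rewrite -ltNge (le_lt_trans ny)// ltr_nat.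
rewrite (eq_bigr (fun=> 1)) => [|k _]; last first.
  by rewrite (le_trans _ (ltW ny))// ler_nat.
rewrite sumr_const card_ord -[in _ *+ n]mulr_natr mul1r.
rewrite -natr1 in yn ny *.
by case: (leP (n%:R + 1) y) => ?; rewrite ?mulr1n ?mulr0n ler_norml;
  apply/andP; split; lra.
Qed.

(** By [floor_sum] applied to [n.+1%:R * xi x], the function [xi] is the uniform
    limit of averages of the indicators of its level sets. *)
Lemma same_bounded : (forall A, measurable A -> same \1_A) ->
  forall xi : T -> R, measurable_fun setT xi -> (forall x, 0 <= xi x <= 1) ->
  same xi.
Proof.
move=> sA xi mxi xi01.
pose E n k := [set x | k.+1%:R / n.+1%:R <= xi x].
have mE n k : measurable (E n k).
  by rewrite -[E n k]setTI; exact: measurable_fun_le.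
pose g n (x : T) : R := \sum_(k < n.+1) n.+1%:R^-1 * \1_(E n k) x.
have Ek n k x : (\1_(E n k) x : R) = (k.+1%:R <= n.+1%:R * xi x)%R%:R.
  rewrite indicE; congr (_%:R); congr nat_of_bool.
  rewrite mulrC -ler_pdivrMr//.
  by apply/idP/idP => [/set_mem//|/mem_set].
have gxi n x : `|g n x - xi x| <= n.+1%:R^-1.
  rewrite /g -mulr_sumr; under eq_bigr do rewrite Ek.
  rewrite -(@ler_pM2l _ n.+1%:R)// divff// -[X in X * _]ger0_norm// -normrM.
  rewrite mulrBr mulrA divff// mul1r floor_sum//.
  have /andP[x0 x1] := xi01 x.
  by rewrite mulr_ge0//= -[leRHS]mulr1 ler_pM2l.
have mg n : measurable_fun setT (g n).
  by apply: measurable_sum => k; apply: measurable_funM => //;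
    exact: measurable_indic.
apply: (@same_limit g _ 2) => //.
- move=> n x; rewrite -(subrK (xi x) (g n x)) (le_trans (ler_normD _ _))//.
  rewrite (natrD _ 1 1) lerD//.
    by rewrite (le_trans (gxi n x))// invf_le1// ler1n.
  by have /andP[x0 x1] := xi01 x; rewrite ger0_norm.
- move=> x; apply/cvgrPdist_le => e e0.
  have := near_infty_natSinv_lt (PosNum e0); apply: filterS => n /= ne.
  by rewrite distrC (le_trans (gxi n x))// ltW.
move=> n; rewrite /g.
have H (s : seq 'I_n.+1) :
    same (fun x => \sum_(k <- s) n.+1%:R^-1 * \1_(E n k) x).
  elim: s => [|k s IH].
    under eq_fun do rewrite big_nil; rewrite /same.
    under eq_Rintegral do rewrite mul0r.
    under [in RHS]eq_Rintegral do rewrite mul0r.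
    by rewrite !Rintegral_cst ?mul0r.
  under eq_fun do rewrite big_cons addrC.
  apply: same_lin => //.
  - by apply: measurable_sum => j; apply: measurable_funM => //; exact: mindic.
  - by apply: bnd_sum => j; apply: bndM; [exact: bnd_cst|exact: bnd_indic].
  - exact: bnd_indic.
  - exact: sA.
exact: H.
Qed.

End indicator_limits.

(** * Countably many test functions *)

(** [T] carries the topology induced by [e]. This is all that is used of
    subspaces of Euclidean space. *)
Definition initial_map (R : realType) m (T : topologicalType) (e : T -> 'rV[R]_m) :=
  continuous e /\ forall V : set T, open V -> exists2 W, open W & e @^-1` W = V.

Section test_functions.
Context (R : realType) (m : nat).
Implicit Types (x : 'rV[R]_m) (a b : 'rV[rat]_m).

Definition gap a b x : R := \prod_(i < m)
  (Num.max 0 (x 0 i - ratr (a 0 i)) * Num.max 0 (ratr (b 0 i) - x 0 i)).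

Definition box a b : set 'rV[R]_m :=
  [set x | forall i, ratr (a 0 i) < x 0 i < ratr (b 0 i)].

(** Two opposite corners of a box, and a slope. *)
Definition test_index : Type := ('rV[rat]_m * 'rV[rat]_m * nat)%type.
HB.instance Definition _ := Countable.on test_index.

(** As the slope grows, these increase to the indicator of the box. *)
Definition test (j : test_index) x : R :=
  Num.min 1 (j.2%:R * gap j.1.1 j.1.2 x).

Lemma gap_ge0 a b x : 0 <= gap a b x.
Proof. by apply: prodr_ge0 => i _; rewrite mulr_ge0// le_max lexx. Qed.

Lemma gap_gt0 a b x : (0 < gap a b x) <-> box a b x.
Proof.
split=> [|xab].
  rewrite lt_def gap_ge0 andbT => /prodf_neq0 g i.
  have := g i isT; rewrite mulf_eq0 negb_or => /andP[].
  rewrite !eq_le !le_max lexx/= !andbT !ge_max !lexx/= -!ltNge.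
  by rewrite subr_gt0 subr_gt0 => -> ->.
apply: prodr_gt0 => i _; have /andP[ax xb] := xab i.
by rewrite mulr_gt0// lt_max subr_gt0 ?ax ?xb orbT.
Qed.

Lemma max_continuous (c : R) : continuous (fun y : R => Num.max c y).
Proof.
move=> y; have := @continuous_max R R (fun=> c) idfun y.
by apply; [exact: cst_continuous|exact: cvg_id].
Qed.

Lemma min_continuous (c : R) : continuous (fun y : R => Num.min c y).
Proof.
move=> y; have := @continuous_min R R (fun=> c) idfun y.
by apply; [exact: cst_continuous|exact: cvg_id].
Qed.

Lemma gap_continuous (T : topologicalType) (e : T -> 'rV[R]_m) a b :
  continuous e -> continuous (fun y => gap a b (e y)).
Proof.
move=> ce; apply: continuous_big => [|i _ x]; first exact: mul_continuous.
have xi : continuous (fun y => e y 0 i).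
  move=> y; apply: (@continuous_comp _ _ _ e (fun v => v 0 i)); first exact: ce.
  exact: coord_continuous.
apply: cvgM.
  apply: (@continuous_comp _ _ _ (fun y => e y 0 i - ratr (a 0 i)) (Num.max 0)).
    by apply: cvgB; [exact: xi|exact: cvg_cst].
  exact: max_continuous.
apply: (@continuous_comp _ _ _ (fun y => ratr (b 0 i) - e y 0 i) (Num.max 0)).
  by apply: cvgB; [exact: cvg_cst|exact: xi].
exact: max_continuous.
Qed.

Lemma test_continuous (T : topologicalType) (e : T -> 'rV[R]_m) j :
  continuous e -> continuous (fun y => test j (e y)).
Proof.
move=> ce x; apply: (@continuous_comp _ _ _
  (fun y => j.2%:R * gap j.1.1 j.1.2 (e y)) (Num.min 1)).
  by apply: cvgM; [exact: cvg_cst|exact: gap_continuous].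
exact: min_continuous.
Qed.

Lemma test01 j x : 0 <= test j x <= 1.
Proof. by rewrite /test le_min ge_min lexx ler01/= mulr_ge0// gap_ge0. Qed.

Lemma test_cvg a b x : test (a, b, n) x @[n --> \oo] --> (\1_(box a b) x : R).
Proof.
rewrite indicE; have [/set_mem/gap_gt0 xab|] := boolP (x \in box a b).
  apply: cvg_near_cst; have := near_infty_natSinv_lt (PosNum xab).
  move=> [N _ NP]; exists N.+1 => // n /= Nn.
  apply/min_idPl; have := NP N (leqnn N); rewrite /= => H.
  have N0 : 0 < N.+1%:R :> R by rewrite ltr0n.
  rewrite (@le_trans _ _ (N.+1%:R * gap a b x))//.
    by rewrite -ler_pdivrMl// mulr1 ltW.
  by rewrite ler_wpM2r ?gap_ge0// ler_nat.
move=> xab; have g0 : gap a b x = 0.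
  apply: le_anti; rewrite gap_ge0 andbT leNgt; apply/negP => /gap_gt0 /mem_set.
  by apply/negP.
by apply: cvg_near_cst; apply: nearW => n; rewrite /test /= g0 mulr0 min_r.
Qed.

Lemma box_nbhs x (W : set 'rV[R]_m) : nbhs x W ->
  exists a b, box a b x /\ box a b `<=` W.
Proof.
move=> /nbhs_ballP[e /= e0 eW].
have lo i : exists q : rat, x 0 i - e < ratr q < x 0 i.
  have /rat_in_itvoo[q qx] : x 0 i - e < x 0 i by rewrite ltrBlDr ltrDl.
  by exists q; move: qx; rewrite in_itv.
have hi i : exists q : rat, x 0 i < ratr q < x 0 i + e.
  have /rat_in_itvoo[q qx] : x 0 i < x 0 i + e by rewrite ltrDl.
  by exists q; move: qx; rewrite in_itv.
have [a aP] := choice lo; have [b bP] := choice hi.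
exists (\row_i a i), (\row_i b i); split=> [i|y yab].
  by rewrite !mxE; have /andP[_ ->] := aP i; have /andP[-> _] := bP i.
apply: eW; split=> // i j; rewrite (ord1 i).
have /andP[a1 a2] := aP j; have /andP[b1 b2] := bP j.
have := yab j; rewrite !mxE => /andP[y1 y2].
by rewrite /ball/= ltr_norml; apply/andP; split; lra.
Qed.

Lemma boxI a b c d : box a b `&` box c d =
  box (map2_mx Num.max a c) (map2_mx Num.min b d).
Proof.
have ratr_max (p q : rat) : ratr (Num.max p q) = Num.max (ratr p) (ratr q) :> R.
  by rewrite !maxEle ler_rat; case: ifP.
have ratr_min (p q : rat) : ratr (Num.min p q) = Num.min (ratr p) (ratr q) :> R.
  by rewrite !minEle ler_rat; case: ifP.
apply/seteqP; split=> [x [ab cd] i|x abcd].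
  rewrite !mxE ratr_max ratr_min gt_max lt_min.
  by have /andP[-> ->] := ab i; have /andP[-> ->] := cd i.
by split=> i; have := abcd i; rewrite !mxE ratr_max ratr_min gt_max lt_min;
  case/andP => /andP[? ?] /andP[? ?]; apply/andP; split.
Qed.

End test_functions.

(** * Test functions determine measures and densities *)

Section separation.
Context (R : realType) (m : nat) (T : ptopologicalType) (e : T -> 'rV[R]_m).
Hypothesis eT : initial_map e.

(** An open set is the union of the rational boxes that it contains, and there
    are countably many of these. *)
Lemma borel_boxes : @measurable _ (borel T) =
  <<s [set e @^-1` box ab.1 ab.2 | ab in [set: 'rV[rat]_m * 'rV[rat]_m]] >>.
Proof.
apply/seteqP; split; apply: smallest_sub;
  try exact: smallest_sigma_algebra.
- move=> V /eT.2[W oW <-].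
  pose S := [set ab : 'rV[rat]_m * 'rV[rat]_m | @box R m ab.1 ab.2 `<=` W].
  rewrite (_ : _ @^-1` _ = \bigcup_(ab in S) e @^-1` box ab.1 ab.2).
    rewrite bigcup_mkcond.
    pose G := [set e @^-1` @box R m ab.1 ab.2 | ab in [set: 'rV[rat]_m * 'rV[rat]_m]].
    change (@measurable _ (g_sigma_algebraType G)
      (\bigcup_i (if i \in S then e @^-1` box i.1 i.2 else set0))).
    apply: countable_bigcupT_measurable => // ab; case: ifPn => // _.
    by apply: sub_sigma_algebra; exists ab.
  apply/seteqP; split=> [x /= Wx|x [ab abW]]; last exact: abW.
  have [|a [b [xab abW]]] := @box_nbhs R m (e x) W; first exact: open_nbhs_nbhs.
  by exists (a, b).
- move=> _ [[a b] _ <-]; apply: sub_sigma_algebra.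
  rewrite (_ : _ @^-1` _ = (fun x => gap a b (e x)) @^-1` [set y | 0 < y]).
    have /continuousP := @gap_continuous R m T e a b eT.1; apply.
    exact: open_gt.
  by apply/seteqP; split=> x; [move=> /gap_gt0|move=> /gap_gt0].
Qed.

(** Test functions converge to indicators of boxes, which form a generating
    family stable under intersection. *)
Lemma tests_separate (mu nu : {measure set (borel T) -> \bar R}) (D1 D2 : T -> R) :
  (mu setT < +oo)%E -> (nu setT < +oo)%E ->
  measurable_fun setT (D1 : borel T -> R) ->
  measurable_fun setT (D2 : borel T -> R) -> bnd D1 -> bnd D2 ->
  \int[mu]_x D1 x = \int[nu]_x D2 x ->
  (forall j, \int[mu]_x (test j (e x) * D1 x) =
             \int[nu]_x (test j (e x) * D2 x)) ->
  forall xi : T -> R, measurable_fun setT (xi : borel T -> R) ->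
  (forall x, 0 <= xi x <= 1) ->
  \int[mu]_x (xi x * D1 x) = \int[nu]_x (xi x * D2 x).
Proof.
move=> muoo nuoo mD1 mD2 bD1 bD2 D12 tD12.
apply: (same_bounded muoo nuoo mD1 mD2 bD1 bD2).
apply: (same_measurable muoo nuoo mD1 mD2 bD1 bD2 borel_boxes).
- move=> _ _ [[a b] _ <-] [[c d] _ <-] /=.
  by rewrite -preimage_setI boxI; eexists (_, _).
- by under eq_Rintegral do rewrite mul1r; rewrite D12;
    under [in RHS]eq_Rintegral do rewrite mul1r.
- move=> _ [[a b] _ <-].
  apply: (same_limit muoo nuoo mD1 mD2 bD1 bD2
      (g_ := fun n x => test (a, b, n) (e x)) (B := 1)).
  + by move=> n; apply: continuous_borelR; apply: test_continuous; exact: eT.1.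
  + by move=> n x; have /andP[t0 t1] := test01 (a, b, n) (e x); rewrite ger0_norm.
  + move=> x; suff -> : (\1_(e @^-1` box a b) x : R) = \1_(box a b) (e x).
      exact: test_cvg.
    by rewrite !indicE.
  + by move=> n; exact: tD12.
Qed.

Lemma tests_separate_measures (mu nu : {measure set (borel T) -> \bar R}) :
  (mu setT < +oo)%E -> (nu setT < +oo)%E -> mu setT = nu setT ->
  (forall j, \int[mu]_x test j (e x) = \int[nu]_x test j (e x)) ->
  forall A, measurable A -> mu A = nu A.
Proof.
move=> muoo nuoo munu tmunu A mA.
have c1 (ka : {measure set (borel T) -> \bar R}) (f : T -> R) :
    \int[ka]_x (f x * 1) = \int[ka]_x f x.
  by congr Rintegral; apply/funext => x; rewrite mulr1.
have := @tests_separate mu nu (cst 1) (cst 1) muoo nuoo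
  (measurable_cst _) (measurable_cst _) (bnd_cst _ _) (bnd_cst _ _).
rewrite !Rintegral_cst// !mul1r munu => /(_ erefl).
have H j : \int[mu]_x (test j (e x) * cst 1 x) =
    \int[nu]_x (test j (e x) * cst 1 x) by rewrite !c1.
have mi : measurable_fun setT (\1_A : borel T -> R) by exact: measurable_indic.
move=> /(_ H \1_A mi); rewrite !c1.
have i01 : forall x, 0 <= (\1_A x : R) <= 1.
  by move=> x; rewrite indicE; case: (_ \in _); rewrite /= ler01 lexx.
move=> /(_ i01); rewrite /Rintegral !integral_indic// !setIT => muA.
have fin (ka : {measure set (borel T) -> \bar R}) : (ka setT < +oo)%E ->
    ka A \is a fin_num.
  by move=> kaoo; rewrite ge0_fin_numE// (le_lt_trans _ kaoo)// le_measure ?inE.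
by rewrite -[LHS]fineK ?fin// muA fineK ?fin.
Qed.

Lemma tests_separate_ae (mu : {measure set (borel T) -> \bar R}) (D1 D2 : T -> R) :
  (mu setT < +oo)%E -> measurable_fun setT (D1 : borel T -> R) ->
  measurable_fun setT (D2 : borel T -> R) -> bnd D1 -> bnd D2 ->
  \int[mu]_x D1 x = \int[mu]_x D2 x ->
  (forall j, \int[mu]_x (test j (e x) * D1 x) =
             \int[mu]_x (test j (e x) * D2 x)) ->
  {ae mu, forall x, D1 x = D2 x}.
Proof.
move=> muoo mD1 mD2 bD1 bD2 D12 tD12.
have ig (D : T -> R) : measurable_fun setT (D : borel T -> R) -> bnd D ->
    mu.-integrable setT (EFin \o D).
  by move=> mD [B DB]; exact: (bounded_integrable muoo mD DB).
have : ae_eq mu setT (EFin \o D1) (EFin \o D2).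
  apply: integral_ae_eq => //; [exact: ig|exact/measurable_EFinP|].
  move=> A _ mA.
  have rst (D : T -> R) : measurable_fun setT (D : borel T -> R) -> bnd D ->
      (\int[mu]_(x in A) (EFin \o D) x)%E = (\int[mu]_x (\1_A x * D x))%:E.
    move=> mD bD; rewrite -[LHS]fineK; last first.
      apply: integrable_fin_num => //; apply: (integrableS measurableT) => //.
      exact: ig.
    rewrite -[fine _]/(\int[mu]_(x in A) D x) Rintegral_mkcond.
    congr (Rintegral _ _ _)%:E; apply/funext => x; rewrite patchE indicE.
    by case: (_ \in _); rewrite ?mul1r ?mul0r.
  rewrite !rst//; congr EFin; apply: (@tests_separate mu mu) => //.
  by move=> x; rewrite indicE; case: (_ \in _); rewrite /= ler01 lexx.
by apply: filterS => x /(_ I) /= [].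
Qed.

Lemma continuous_separate_ae (mu : {measure set (borel T) -> \bar R})
    (D1 D2 : T -> R) :
  (mu setT < +oo)%E -> measurable_fun setT (D1 : borel T -> R) ->
  measurable_fun setT (D2 : borel T -> R) -> bnd D1 -> bnd D2 ->
  (forall F : T -> R, continuous F -> (forall x, 0 <= F x) ->
    \int[mu]_x (F x * D1 x) = \int[mu]_x (F x * D2 x)) ->
  {ae mu, forall x, D1 x = D2 x}.
Proof.
move=> muoo mD1 mD2 bD1 bD2 FD; apply: tests_separate_ae => // [|j].
  have := FD (cst 1) (@cst_continuous _ _ _) (fun=> ler01).
  under eq_Rintegral do rewrite mul1r.
  by under [in RHS]eq_Rintegral do rewrite mul1r.
apply: FD; first by apply: test_continuous; exact: eT.1.
by move=> x; have /andP[] := test01 j (e x).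
Qed.

End separation.

(** * Disintegration of a mean *)

Lemma ae_eq_Rintegral d (T : measurableType d) (R : realType)
    (mu : {measure set T -> \bar R}) (f g : T -> R) :
  measurable_fun setT f -> measurable_fun setT g ->
  {ae mu, forall x, f x = g x} -> \int[mu]_x f x = \int[mu]_x g x.
Proof.
move=> mf mg fg; congr fine; apply: ae_eq_integral => //.
- exact/measurable_EFinP.
- exact/measurable_EFinP.
- by apply: filterS fg => x /= -> _.
Qed.

Lemma ae_forall_countable d (T : measurableType d) (R : realType)
    (mu : {measure set T -> \bar R}) (J : countType) (P : J -> T -> Prop) :
  (forall j, {ae mu, forall x, P j x}) -> {ae mu, forall x, forall j, P j x}.
Proof.
move=> aeP.
pose Q (n : nat) x := forall j, unpickle n = Some j -> P j x.
have H : {ae mu, forall x, forall n, Q n x}.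
  apply: ae_foralln => n; case E : (@unpickle J n) => [j|].
    by apply: filterS (aeP j) => x Px j'; rewrite E => -[<-].
  by apply: aeW => x j'; rewrite E.
by apply: filterS H => x H j; apply: (H (pickle j)); rewrite pickleK.
Qed.

(** The mean [m] is thought of as the law of a random index [i], and [mu] as
    the law of [p i]. *)
Section disintegration.
Context (R : realType) (I : Type) (m : (I -> R) -> R).
Hypothesis mm : is_mean m.
Context (k : nat) (Z : ptopologicalType) (e : Z -> 'rV[R]_k).
Context (fZ : cantor_space -> Z) (p : I -> Z).
Hypotheses (eZ : initial_map e) (fZi : cantor_image fZ).
Variable mu : {finite_measure set (borel Z) -> \bar R}.
Hypothesis muE : forall phi : Z -> R, continuous phi ->
  \int[mu]_z phi z = m (fun i => phi (p i)).

Let muoo : (mu setT < +oo)%E.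
Proof. by rewrite -ge0_fin_numE// fin_num_measure. Qed.

Lemma disintegration_mass : mu setT = (m (fun=> 1))%:E.
Proof.
have := muE (@cst_continuous Z R 1).
rewrite Rintegral_cst// mul1r => <-; rewrite fineK//.
by rewrite fin_num_measure.
Qed.

(** The conditional expectation of [G] given [p]. Both [G] and [1 - G] define
    measures with sum [mu], so that these are absolutely continuous, and their
    Radon-Nikodym densities add up to 1; this bounds the density of [G] by 1
    almost everywhere, and truncation makes the bound hold everywhere. *)
Lemma mean_density (G : I -> R) : (forall i, 0 <= G i <= 1) ->
  exists psi : Z -> R, [/\ measurable_fun setT (psi : borel Z -> R),
    forall z, 0 <= psi z <= 1 &
    forall F : Z -> R, continuous F -> (forall z, 0 <= F z) ->
      \int[mu]_z (F z * psi z) = m (fun i => F (p i) * G i)].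
Proof.
move=> G01.
have bG : bnd G.
  by exists 1 => i; have /andP[G0 G1] := G01 i; rewrite ger0_norm.
have bG' : bnd (fun i => 1 - G i) by apply: bndD (bnd_cst _ _) (bndN bG).
have [nu [nuT nuI]] := mean_measure p mm fZi bG
  (fun i => (andP (G01 i)).1).
have G'0 i : 0 <= 1 - G i by have /andP[_ ?] := G01 i; rewrite subr_ge0.
have [nu' [nuT' nuI']] := mean_measure p mm fZi bG' G'0.
have nuoo : (nu setT < +oo)%E by rewrite nuT ltry.
have nuoo' : (nu' setT < +oo)%E by rewrite nuT' ltry.
have mG : m (fun=> 1) = m G + m (fun i => 1 - G i).
  by rewrite -(meanD mm)//; congr m; apply/funext => i; rewrite addrC subrK.
pose ka : {measure set (borel Z) -> \bar R} := measure_add nu nu'.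
have kaE A : ka A = (nu A + nu' A)%E by exact: measure_addE.
have nunu' A : measurable A -> mu A = (nu A + nu' A)%E.
  move=> mA; rewrite -kaE.
  apply: (tests_separate_measures eZ) => //.
  - by rewrite kaE lte_add_pinfty.
  - by rewrite [RHS]kaE [LHS]disintegration_mass mG EFinD; congr (_ + _)%E.
  - move=> j; have cj : continuous (fun z => test j (e z)).
      by apply: test_continuous; exact: eZ.1.
    have bj : forall z, `|test j (e z)| <= 1.
      by move=> z; have /andP[t0 t1] := test01 j (e z); rewrite ger0_norm.
    have mj := continuous_borelR cj.
    have inu := bounded_integrable nuoo mj bj.
    have inu' := bounded_integrable nuoo' mj bj.
    have kaI : \int[ka]_z test j (e z) =
        \int[nu]_z test j (e z) + \int[nu']_z test j (e z).
      rewrite /Rintegral integral_measure_add//.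
      by rewrite fineD//; exact: integrable_fin_num.
    transitivity (m (fun i => test j (e (p i)))); first exact: (muE cj).
    rewrite kaI (nuI _ cj) (nuI' _ cj) -(meanD mm).
    + by congr m; apply/funext => i; rewrite -mulrDr addrC subrK mulr1.
    + by apply: bndM => //; exists 1 => i.
    + by apply: bndM => //; exists 1 => i.
have numu : nu `<< mu.
  apply/null_content_dominatesP => A mA muA.
  have E : (nu A + nu' A = 0)%E by rewrite -nunu'.
  by apply/eqP; rewrite eq_le measure_ge0 andbT -E leeDl.
have numu' : nu' `<< mu.
  apply/null_content_dominatesP => A mA muA.
  have E : (nu A + nu' A = 0)%E by rewrite -nunu'.
  by apply/eqP; rewrite eq_le measure_ge0 andbT -E leeDr.
pose f := Radon_Nikodym_SigmaFinite.f nu mu.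
pose f' := Radon_Nikodym_SigmaFinite.f nu' mu.
have f0 := Radon_Nikodym_SigmaFinite.f_ge0 numu.
have f0' := Radon_Nikodym_SigmaFinite.f_ge0 numu'.
have fi := Radon_Nikodym_SigmaFinite.f_integrable numu.
have fi' := Radon_Nikodym_SigmaFinite.f_integrable numu'.
have ff := Radon_Nikodym_SigmaFinite.f_fin_num numu.
have ff' := Radon_Nikodym_SigmaFinite.f_fin_num numu'.
have fE A : measurable A -> (\int[mu]_(z in A) f z = nu A)%E.
  by move=> mA; rewrite -Radon_Nikodym_SigmaFinite.f_integral.
have fE' A : measurable A -> (\int[mu]_(z in A) f' z = nu' A)%E.
  by move=> mA; rewrite -Radon_Nikodym_SigmaFinite.f_integral.
have f1 : ae_eq mu setT (f \+ f') (cst 1%E).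
  apply: integral_ae_eq => //; first exact: integrableD.
  move=> A _ mA; rewrite integralD//.
  - by rewrite fE// fE'// integral_cst// mul1e -nunu'.
  - exact: integrableS fi.
  - exact: integrableS fi'.
have mf : measurable_fun setT (fun z => fine (f z)).
  by apply: measurableT_comp => //; exact: measurable_int fi.
exists (fun z => Num.min 1 (fine (f z))); split.
- exact: measurable_minr.
- by move=> z; rewrite le_min ge_min lexx ler01 fine_ge0.
move=> F cF F0.
have mF := continuous_borelR cF.
have [B FB] := cantor_image_bnd fZi cF.
rewrite -nuI//; transitivity (\int[mu]_z (F z * fine (f z))); last first.
- congr fine; rewrite -(Radon_Nikodym_SigmaFinite.change_of_variables numu)//.
  + by apply: eq_integral => z _; rewrite EFinM fineK//; exact: ff.
  + exact/measurable_EFinP.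
apply: ae_eq_Rintegral.
- by apply: measurable_funM => //; exact: measurable_minr.
- exact: measurable_funM.
- apply: filterS f1 => z /(_ Logic.I) /= fz; congr (_ * _).
  have fz1 : fine (f z) <= 1.
    by rewrite -lee_fin fineK ?ff// -fz leeDl// f0'.
  exact: min_r.
Qed.

(** The conditional masses [psi a] of the words [a] are additive in [a] only
    almost everywhere. Taking the mass of [false :: a], but never more than is
    available, and leaving the rest to [true :: a], gives masses that are
    additive everywhere and that agree with [psi] wherever it was additive. *)
Fixpoint split_density (psi : seq bool -> Z -> R) (a : seq bool) (z : Z) : R :=
  if a is b :: a' then
    let l := Num.min (split_density psi a' z) (psi (false :: a') z) in
    if b then split_density psi a' z - l else l
  else 1.

Section split_density.
Variable psi : seq bool -> Z -> R.
Hypothesis psi_ge0 : forall a z, 0 <= psi a z.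
Hypothesis mpsi : forall a, measurable_fun setT (psi a : borel Z -> R).

Lemma split_density_ge0 a z : 0 <= split_density psi a z.
Proof.
elim: a => //= b a IH; case: b; first by rewrite subr_ge0 ge_min lexx.
by rewrite le_min IH psi_ge0.
Qed.

Lemma split_densityD a z :
  split_density psi (false :: a) z + split_density psi (true :: a) z =
  split_density psi a z.
Proof. by rewrite /= addrC subrK. Qed.

Lemma measurable_split_density a :
  measurable_fun setT (split_density psi a : borel Z -> R).
Proof.
elim: a => [|b a IH]; first exact: measurable_cst.
have ml : measurable_fun setT (fun z : borel Z =>
    Num.min (split_density psi a z) (psi (false :: a) z)).
  exact: measurable_minr.
by case: b => //=; exact: measurable_funB.
Qed.

Lemma split_density_le1 a z : split_density psi a z <= 1.
Proof.
elim: a => //= b a IH; apply: le_trans IH.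
case: b; last by rewrite ge_min lexx.
by rewrite gerBl le_min psi_ge0 split_density_ge0.
Qed.

Lemma split_density_ae (nu : {measure set (borel Z) -> \bar R}) :
  {ae nu, forall z, psi [::] z = 1} ->
  (forall a, {ae nu, forall z, psi (false :: a) z + psi (true :: a) z = psi a z}) ->
  {ae nu, forall z, forall a, split_density psi a z = psi a z}.
Proof.
move=> psi1 psiD.
have : {ae nu, forall z, forall a, psi (false :: a) z + psi (true :: a) z = psi a z}.
  exact: ae_forall_countable.
move=> {}psiD.
apply: (@filterS2 _ _ (ae_filter_ringOfSetsType nu) _ _ _ _ psi1 psiD) => z p1 pD.
elim=> [|b a IH]; first by rewrite p1.
rewrite /= IH -{1 2 3}pD min_r; last by rewrite lerDl.
by case: b => //; rewrite addrAC subrr add0r.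
Qed.

End split_density.

(** The conditional law of [q] given [p]. The conditional masses of the words
    coding [q] form an additive function of words at each [z], hence a measure
    there; integrating the sums over words of length [j] against [mu] and
    letting [j] grow gives back the joint law. *)
Lemma mean_disintegration (T : ptopologicalType) (f : cantor_space -> T)
    (q : I -> T) : cantor_image f ->
  exists lam : Z -> {finite_measure set (borel T) -> \bar R},
  [/\ forall z, lam z setT = 1%E,
    forall phi : T -> R, continuous phi ->
      measurable_fun setT ((fun z => \int[lam z]_w phi w) : borel Z -> R) &
    forall (F : Z -> R) (phi : T -> R), continuous F -> (forall z, 0 <= F z) ->
      continuous phi ->
      \int[mu]_z (F z * \int[lam z]_w phi w) =
      m (fun i => F (p i) * phi (q i))].
Proof.
move=> fT.
have [code codeE] := choice (fun i => fT.2 (q i)).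
pose G a i : R := (word (code i) (size a) == a)%:R.
have bG a : bnd (G a) by exact: bnd_bool.
have G01 a i : 0 <= G a i <= 1.
  by rewrite /G; case: (_ == _); rewrite /= lexx ler01.
have [psi psiP] := choice (fun a => mean_density (G01 a)).
have mpsi a : measurable_fun setT (psi a : borel Z -> R) by have [] := psiP a.
have psi01 a z : 0 <= psi a z <= 1 by have [_ ->] := psiP a.
have psi0 a z : 0 <= psi a z by have /andP[] := psi01 a z.
have bpsi a : bnd (psi a).
  by exists 1 => z; have /andP[] := psi01 a z => ? ?; rewrite ger0_norm.
have psiI a (F : Z -> R) : continuous F -> (forall z, 0 <= F z) ->
    \int[mu]_z (F z * psi a z) = mean_word m code (fun i => F (p i)) a.
  have [_ _ H] := psiP a; move=> cF F0; rewrite H//.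
  by congr m; apply/funext => i; rewrite mulrC.
have bF (F : Z -> R) : continuous F -> bnd F := cantor_image_bnd fZi.
pose ig (h : Z -> R) := (mu : {measure set (borel Z) -> \bar R}).-integrable
  setT (EFin \o h).
have igF (F h : Z -> R) : continuous F ->
    measurable_fun setT (h : borel Z -> R) -> bnd h -> ig (fun z => F z * h z).
  move=> cF mh bh; have [B FB] := bndM (bF _ cF) bh.
  apply: (bounded_integrable muoo _ FB).
  by apply: measurable_funM => //; exact: continuous_borelR.
pose sd := split_density psi.
have sd0 a z : 0 <= sd a z by exact: split_density_ge0.
have bsd a : bnd (sd a).
  by exists 1 => z; rewrite ger0_norm//; exact: split_density_le1.
have msd a : measurable_fun setT (sd a : borel Z -> R).
  exact: measurable_split_density.
have sd_ae : {ae (mu : {measure set (borel Z) -> \bar R}),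
    forall z, forall a, sd a z = psi a z}.
  apply: split_density_ae; first exact: psi0.
    apply: (continuous_separate_ae eZ (D1 := psi [::]) (D2 := cst 1)) => //.
      exact: bnd_cst.
    move=> F cF F0; rewrite psiI// mean_word_nil -muE//.
    by congr Rintegral; apply/funext => z; rewrite mulr1.
  move=> a; apply: (continuous_separate_ae eZ (D2 := psi a)
    (D1 := fun z => psi (false :: a) z + psi (true :: a) z)) => //.
  - exact: measurable_funD.
  - exact: bndD.
  - move=> F cF F0; rewrite psiI// -(mean_wordD code mm)//; last first.
      exact: bnd_comp (bF _ cF).
    rewrite -!psiI// -RintegralD//; [|exact: igF|exact: igF].
    by congr Rintegral; apply/funext => z; rewrite mulrDr.
have [lam lamP] := choice (fun z => tree_measure fT.1 (sd0 ^~ z)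
  (fun a => split_densityD psi a z)).
exists lam; split.
- by move=> z; have [-> _] := lamP z.
- move=> phi cphi; have [B phiB] := cantor_image_bnd fT cphi.
  pose h j z := \sum_(a : j.-tuple bool) phi (f (word_point a)) * sd a z.
  apply: (@measurable_fun_cvg _ (borel Z) R _ h).
    move=> j; apply: measurable_sum => a.
    by apply: measurable_funM => //; exact: measurable_cst.
  by move=> z _; have [_ /(_ _ cphi _ phiB)[]] := lamP z.
move=> F phi cF F0 cphi; have [B phiB] := cantor_image_bnd fT cphi.
have [C FC] := bF _ cF.
pose h j z := \sum_(a : j.-tuple bool) phi (f (word_point a)) * sd a z.
have c1 : \int[mu]_z (F z * h j z) @[j --> \oo] -->
    \int[mu]_z (F z * \int[lam z]_w phi w).
  apply: (@bounded_cvg_Rintegral _ (borel Z) _ mu muoo _ _ (C * B)).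
  - move=> j; apply: measurable_funM; first exact: continuous_borelR.
    apply: measurable_sum => a.
    by apply: measurable_funM => //; exact: measurable_cst.
  - move=> j z; rewrite normrM ler_pM//.
    have [_ /(_ _ cphi _ phiB)[/(_ j)]] := lamP z.
    by rewrite /= mulr1.
  - move=> z; apply: cvgMr.
    by have [_ /(_ _ cphi _ phiB)[]] := lamP z.
have bFp : bnd (fun i => F (p i)) by exact: bnd_comp (bF _ cF).
have c2 := mean_word_cvg (code := code) mm fT cphi bFp.
have hE j : \int[mu]_z (F z * h j z) = \sum_(a : j.-tuple bool)
    phi (f (word_point a)) * mean_word m code (fun i => F (p i)) a.
  transitivity (\int[mu]_z (\sum_(a : j.-tuple bool)
      phi (f (word_point a)) * (F z * sd a z))).
    congr Rintegral; apply/funext => z; rewrite mulr_sumr; apply: eq_bigr => a _.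
    by rewrite mulrCA.
  rewrite (Rintegral_sum (mu := mu)); last first.
    move=> a; have [D bD] := bndM (bnd_cst Z (phi (f (word_point a))))
      (bndM (bF _ cF) (bsd a)).
    apply: (bounded_integrable muoo _ bD).
    apply: measurable_funM; first exact: measurable_cst.
    by apply: measurable_funM => //; exact: continuous_borelR.
  apply: eq_bigr => a _; rewrite RintegralZl//; last exact: igF.
  congr (_ * _); rewrite -psiI//; apply: ae_eq_Rintegral.
  - by apply: measurable_funM => //; exact: continuous_borelR.
  - by apply: measurable_funM => //; exact: continuous_borelR.
  - by apply: (@filterS _ _ (ae_filter_ringOfSetsType mu) _ _ _ sd_ae) => z /= ->.
rewrite (funext hE) in c1.
rewrite (cvg_unique (@Rhausdorff R) c1 c2).
by congr m; apply/funext => i; rewrite codeE mulrC.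
Qed.

End disintegration.

(** * The closed ball and the sphere as compact metrizable spaces *)

(** Surjections from the Cantor set are constructed from the metric of
    the subspaces. *)
HB.instance Definition _ (R : realType) m :=
  PseudoMetric.copy (hbar R m) (set_type (@closed_ball1 R m)).
HB.instance Definition _ (R : realType) m :=
  PseudoMetric.copy (bdry R m.+1) (set_type (@unit_sphere R m.+1)).

Section initial_maps.
Context (R : realType) (m : nat) (T : topologicalType) (e : T -> 'rV[R]_m).
Hypothesis eT : initial_map e.

Lemma initial_map_continuous (U : topologicalType) (F : U -> T) :
  continuous (e \o F) -> continuous F.
Proof.
move=> ceF; apply/continuousP => V /eT.2[W oW <-].
by move/continuousP : ceF; exact.
Qed.

Lemma initial_map_hausdorff : injective e -> hausdorff_space T.
Proof.
move=> ie x y xy; apply: ie; apply: (@norm_hausdorff _ 'rV[R]_m) => A B xA yB.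
have [z [zA zB]] := xy (e @^-1` A) (e @^-1` B) (eT.1 _ _ xA) (eT.1 _ _ yB).
by exists (e z).
Qed.

Lemma initial_map_compact : compact (range e) -> compact [set: T].
Proof.
move=> cr F FF FF_; have [|_ [[x _ <-] xF]] := cr (e @ F) _.
  by apply: (@filterS _ F _ _ _ _ FF_) => y _ /=; exists y.
exists x; split=> // A V FA xV.
have [W /= [oW Wx WV]] : exists W, [/\ open W, W (e x) & e @^-1` W `<=` V].
  move: xV; rewrite nbhsE => -[V' [/eT.2[W oW <-] Wx] WV].
  by exists W.
have [||_ [[y Ay <-] Wy]] := xF (e @` A) W.
- by apply: (@filterS _ F _ _ _ _ FA) => y Ay /=; exists y.
- exact: open_nbhs_nbhs.
by exists y; split=> //; exact: WV.
Qed.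

End initial_maps.

Section ball_model.
Context (R : realType) (m : nat).
Implicit Types (u v w : 'rV[R]_m).

Lemma sqnorm_ge0 v : 0 <= sqnorm v.
Proof. by apply: sumr_ge0 => i _; rewrite sqr_ge0. Qed.

Lemma sqnorm_eq0 v : (sqnorm v == 0) = (v == 0).
Proof.
apply/idP/eqP => [|->]; last by rewrite /sqnorm big1// => i _; rewrite mxE expr0n.
rewrite psumr_eq0 => [/allP v0|i _]; last exact: sqr_ge0.
apply/rowP => i; rewrite mxE; apply/eqP; rewrite -sqrf_eq0.
by apply: v0; rewrite mem_index_enum.
Qed.

Lemma sqnormN v : sqnorm (- v) = sqnorm v.
Proof. by apply: eq_bigr => i _; rewrite mxE sqrrN. Qed.

Lemma sqnormBC u v : sqnorm (u - v) = sqnorm (v - u).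
Proof. by rewrite -sqnormN opprB. Qed.

Lemma sqnormZ c v : sqnorm (c *: v) = c ^+ 2 * sqnorm v.
Proof. by rewrite /sqnorm mulr_sumr; apply: eq_bigr => i _; rewrite mxE exprMn. Qed.

Lemma sqnorm_coord v i : v 0 i ^+ 2 <= sqnorm v.
Proof. by rewrite /sqnorm (bigD1 i)//= lerDl sumr_ge0// => j _; rewrite sqr_ge0. Qed.

(** Polarization: the distances of [v] to 0 and to half of a basis vector
    determine the corresponding coordinate. The factor 2 keeps both points
    inside the open ball. *)
Lemma sqnormB_delta v i :
  v 0 i = sqnorm v + 4^-1 - sqnorm (v - 2^-1 *: delta_mx 0 i).
Proof.
rewrite /sqnorm (bigD1 i)//= [in X in _ - X](bigD1 i)//=.
have -> : \sum_(j < m | j != i) (v - 2^-1 *: delta_mx 0 i) 0 j ^+ 2 =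
    \sum_(j < m | j != i) v 0 j ^+ 2.
  apply: eq_bigr => j /negbTE ji.
  by rewrite !mxE ji andbF mulr0 subr0.
by rewrite !mxE !eqxx/=; field.
Qed.

Lemma sqnorm_continuous (T : topologicalType) (F : T -> 'rV[R]_m) :
  continuous F -> continuous (fun x => sqnorm (F x)).
Proof.
move=> cF; apply: continuous_big => [|i _ x]; first exact: add_continuous.
apply: (@continuous_comp _ _ _ (fun y => F y 0 i) (fun t => t ^+ 2)).
  apply: (@continuous_comp _ _ _ F (fun v => v 0 i)); first exact: cF.
  exact: coord_continuous.
exact: exprn_continuous.
Qed.

Definition hbar_val (x : hbar R m) : 'rV[R]_m := \val x.
Definition bdry_val (x : bdry R m) : 'rV[R]_m := \val x.

Lemma hbar_initial : initial_map hbar_val.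
Proof. by split; [exact: initial_continuous|move=> V [W oW <-]; exists W]. Qed.

Lemma bdry_initial : initial_map bdry_val.
Proof. by split; [exact: initial_continuous|move=> V [W oW <-]; exists W]. Qed.

Lemma compact_sqnorm_le (A : set R) : closed A -> A `<=` [set t | t <= 1] ->
  compact [set v | A (@sqnorm R m v)].
Proof.
move=> cA A1; apply: bounded_closed_compact.
  exists 1; split; first exact: num_real.
  move=> M M1 v /A1/= v1; rewrite (le_trans _ (ltW M1))//.
  rewrite /Num.Def.normr/= mx_normrE; apply: bigmax_le => // -[i j] _ /=.
  rewrite (ord1 i) -(@ler_pXn2r _ 2)// ?nnegrE// expr1n real_normK ?num_real//.
  exact: le_trans (sqnorm_coord _ _) v1.
apply: (@closed_comp _ _ (@sqnorm R m)) => // v _.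
by apply: (@sqnorm_continuous _ idfun) => w; exact: cvg_id.
Qed.

Lemma range_set_val (A : set 'rV[R]_m) : range (fun x : set_type A => \val x) = A.
Proof.
apply/seteqP; split=> [_ [x _ <-]|x Ax]; first exact: (set_mem (valP x)).
by exists (SigSub (mem_set Ax)).
Qed.

Lemma hbar_cantor : exists f : cantor_space -> hbar R m, cantor_image f.
Proof.
have ch : compact [set: hbar R m].
  apply: (initial_map_compact hbar_initial); rewrite range_set_val.
  apply: (@compact_sqnorm_le [set t | t <= 1]) => //; exact: closed_le.
have hh : hausdorff_space (hbar R m).
  by apply: (initial_map_hausdorff hbar_initial); exact: val_inj.
have [f cf] := cantor_surj (T := hbar R m) ch hh.
exists f; split=> // y.
by have [x _ <-] := @surj _ _ _ _ f y Logic.I; exists x.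
Qed.

End ball_model.

Lemma bdry_cantor (R : realType) (m : nat) :
  exists f : cantor_space -> bdry R m.+1, cantor_image f.
Proof.
have cb : compact [set: bdry R m.+1].
  apply: (initial_map_compact (@bdry_initial R m.+1)); rewrite range_set_val.
  apply: (@compact_sqnorm_le _ _ [set 1]); first exact: closed_eq.
  by move=> x /= ->; rewrite /= lexx.
have hb : hausdorff_space (bdry R m.+1).
  by apply: (initial_map_hausdorff (@bdry_initial R m.+1)); exact: val_inj.
have [f cf] := cantor_surj (T := bdry R m.+1) cb hb.
exists f; split=> // y.
by have [x _ <-] := @surj _ _ _ _ f y Logic.I; exists x.
Qed.

(** * Continuous extension of isometries to the closed ball *)

Section real_continuous.
Context (R : realType) (T : topologicalType).
Implicit Types f g : T -> R.

Lemma continuous_funD f g : continuous f -> continuous g ->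
  continuous (fun x => f x + g x).
Proof. by move=> cf cg x; apply: cvgD; [exact: cf|exact: cg]. Qed.

Lemma continuous_funB f g : continuous f -> continuous g ->
  continuous (fun x => f x - g x).
Proof. by move=> cf cg x; apply: cvgB; [exact: cf|exact: cg]. Qed.

Lemma continuous_funM f g : continuous f -> continuous g ->
  continuous (fun x => f x * g x).
Proof. by move=> cf cg x; apply: cvgM; [exact: cf|exact: cg]. Qed.

Lemma continuous_funV f : continuous f -> (forall x, 0 < f x) ->
  continuous (fun x => (f x)^-1).
Proof.
by move=> cf f0 x; apply: cvgV; [exact: lt0r_neq0|exact: cf].
Qed.

End real_continuous.

Lemma row_continuous (R : realType) (m : nat) (T : topologicalType)
    (F : T -> 'rV[R]_m) :
  (forall i, continuous (fun x => F x 0 i)) -> continuous F.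
Proof.
move=> cF x; apply/cvg_ballP => r r0.
have H : \forall y \near x, forall i, ball (F x 0 i) r (F y 0 i).
  apply: filter_forall => i; have /cvg_ballP := cF i x; exact.
by apply: filterS H => y Hy; split=> // i j; rewrite (ord1 i).
Qed.

(** [arcosh t] is the logarithm of some [a] with [t = (a + a^-1) / 2]. *)
Lemma arcosh_inj (R : realType) : {in [pred t : R | 1 <= t] &, injective (@arcosh R)}.
Proof.
have E (t : R) : 1 <= t -> let a := t + Num.sqrt (t ^+ 2 - 1) in
    0 < a /\ t = (a + a^-1) / 2.
  move=> t1; have t0 : 0 <= t ^+ 2 - 1 by rewrite subr_ge0 exprn_ege1.
  have s0 := sqrtr_ge0 (t ^+ 2 - 1); have s2 := sqr_sqrtr t0.
  set s := Num.sqrt _ in s0 s2 *; move=> a.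
  have a0 : 0 < a by rewrite /a; lra.
  split=> //; have -> : a^-1 = t - s.
    apply: (@mulfI _ a); first exact: lt0r_neq0.
    by rewrite divff ?lt0r_neq0// /a; nra.
  by rewrite /a; lra.
move=> s t; rewrite !inE => /E[s0 sE] /E[t0 tE] /ln_inj st.
by rewrite sE tE st// posrE.
Qed.

Section isometry_extension.
Context (R : realType) (m : nat).
Notation H := (hyp R m).
Notation Hbar := (hbar R m).

(** The conformal weight of the ball model: the metric is Euclidean up to the
    factor [2 / wt], and the boundary is the zero set of [wt]. *)
Definition wt (x : Hbar) : R := 1 - sqnorm (hbar_val x).

Notation hv x := (hbar_val (hyp_hbar x)).

Lemma wt_ge0 x : 0 <= wt x.
Proof. by rewrite subr_ge0; exact: (set_mem (valP x)). Qed.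

Lemma wt_gt0 (x : H) : 0 < wt (hyp_hbar x).
Proof. by rewrite subr_gt0; exact: (set_mem (valP x)). Qed.

Lemma wt_bdry (z : bdry R m) : wt (bdry_hbar z) = 0.
Proof.
by apply/eqP; rewrite subr_eq0 eq_sym; apply/eqP; exact: (set_mem (valP z)).
Qed.

Lemma wt_eq0 (x : Hbar) : wt x = 0 -> exists z, bdry_hbar z = x.
Proof.
move=> x0; have zP : hbar_val x \in @unit_sphere R m.
  by apply/mem_set/eqP; rewrite eq_sym -subr_eq0 -/(wt x) x0.
by exists (SigSub zP); apply: val_inj.
Qed.

Lemma hdistE (x y : H) : hdist x y = arcosh (1 + 2 * sqnorm (hv x - hv y) /
  (wt (hyp_hbar x) * wt (hyp_hbar y))).
Proof. by []. Qed.

(** The distance determines the quotient of the squared chord by the weights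
    of its end points. *)
Lemma isom_chord (g : isom R m) (x y : H) :
  sqnorm (hv (g x) - hv (g y)) * (wt (hyp_hbar x) * wt (hyp_hbar y)) =
  sqnorm (hv x - hv y) * (wt (hyp_hbar (g x)) * wt (hyp_hbar (g y))).
Proof.
have w0 a b : 0 < wt (hyp_hbar a) * wt (hyp_hbar b) by rewrite mulr_gt0 ?wt_gt0.
have ge1 a b : 1 + 2 * sqnorm (hv a - hv b) /
    (wt (hyp_hbar a) * wt (hyp_hbar b)) \in [pred t : R | 1 <= t].
  by rewrite inE lerDl divr_ge0 ?(ltW (w0 _ _))// mulr_ge0// sqnorm_ge0.
have := isom_dist g x y; rewrite !hdistE => /arcosh_inj.
move=> /(_ (ge1 _ _) (ge1 _ _)) /addrI E.
apply/eqP; rewrite -eqr_div ?lt0r_neq0//; apply/eqP.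
by apply: (@mulfI _ 2); rewrite ?pnatr_eq0// !mulrA.
Qed.

Lemma open_ball0 : (0 : 'rV[R]_m) \in @open_ball R m.
Proof.
by apply/mem_set; rewrite /open_ball /sqnorm /= big1// => i _; rewrite mxE expr0n.
Qed.

Definition origin : H := SigSub open_ball0.

Lemma sqnorm_half_basis (i : 'I_m) :
  sqnorm (2^-1 *: delta_mx 0 i : 'rV[R]_m) = 4^-1.
Proof.
rewrite sqnormZ /sqnorm (bigD1 i)//= big1 => [|j /negbTE ji].
  by rewrite mxE !eqxx /= expr1n addr0; field.
by rewrite mxE ji andbF expr0n.
Qed.

Lemma open_ball_half_basis (i : 'I_m) :
  (2^-1 *: delta_mx 0 i : 'rV[R]_m) \in @open_ball R m.
Proof. by apply/mem_set; rewrite /open_ball/= sqnorm_half_basis; lra. Qed.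

Definition half_basis i : H := SigSub (open_ball_half_basis i).

(** If [g b = 0] then [g] multiplies [wt] by [wt b / conf_den b], by the chord
    identity for [b]. This is positive on the closed ball: if the first term
    vanishes then [y = b] is an interior point, and the second one is positive. *)
Definition conf_den (b : H) (y : Hbar) : R :=
  sqnorm (hbar_val y - hv b) + wt (hyp_hbar b) * wt y.

Lemma conf_den_gt0 b y : 0 < conf_den b y.
Proof.
rewrite /conf_den; have [yb|yb] := eqVneq (hbar_val y) (hv b).
  rewrite ltr_wpDl ?sqnorm_ge0// mulr_gt0 ?wt_gt0//.
  by rewrite /wt yb wt_gt0.
rewrite ltr_pwDl ?mulr_ge0 ?wt_ge0// lt_def sqnorm_ge0 andbT.
by rewrite sqnorm_eq0 subr_eq0.
Qed.

Lemma wt_continuous : continuous wt.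
Proof.
apply: continuous_funB; first exact: cst_continuous.
by apply: sqnorm_continuous; exact: (@hbar_initial R m).1.
Qed.

Lemma hbar_valB_continuous (v : 'rV[R]_m) :
  continuous (fun y : Hbar => hbar_val y - v).
Proof.
apply: row_continuous => i.
rewrite (_ : (fun y => _) = fun y : Hbar => hbar_val y 0 i - v 0 i); last first.
  by apply/funext => y; rewrite !mxE.
have ci : continuous (fun x : Hbar => hbar_val x 0 i).
  move=> y; apply: (@continuous_comp Hbar 'rV[R]_m R (@hbar_val R m)
    (fun u : 'rV[R]_m => u 0 i)).
    exact: (@hbar_initial R m).1.
  exact: coord_continuous.
by apply: continuous_funB; [exact: ci|exact: cst_continuous].
Qed.

Lemma conf_den_continuous b : continuous (conf_den b).
Proof.
apply: continuous_funD.
  by apply: sqnorm_continuous; exact: hbar_valB_continuous.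
by apply: continuous_funM; [exact: cst_continuous|exact: wt_continuous].
Qed.

Lemma wt_isom (g : isom R m) (y : H) :
  wt (hyp_hbar (g y)) = wt (hyp_hbar (isom_inv g origin)) * wt (hyp_hbar y) /
    conf_den (isom_inv g origin) (hyp_hbar y).
Proof.
set b := isom_inv g origin.
have gb : hv (g b) = 0 by rewrite /b isom_invK.
have wgb : wt (hyp_hbar (g b)) = 1.
  by rewrite /wt gb /sqnorm big1 ?subr0// => i _; rewrite mxE expr0n.
have := isom_chord g y b; rewrite gb wgb subr0 mulr1.
have -> : sqnorm (hv (g y)) = 1 - wt (hyp_hbar (g y)) by rewrite /wt; ring.
move=> E; apply/eqP; rewrite -subr_eq0; apply/eqP.
have d0 := lt0r_neq0 (conf_den_gt0 b (hyp_hbar y)).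
apply: (mulIf d0); rewrite mul0r mulrBl divfK// /conf_den.
by move: E; lra.
Qed.

(** By [sqnormB_delta], the [i]-th coordinate of [g y] is determined by the
    chords from [g y] to 0 and to half of the basis vector, which
    are given by the chord identity at their preimages [b] and [x]. *)
Lemma isom_coord (g : isom R m) (y : H) i :
  let b := isom_inv g origin in let x := isom_inv g (half_basis i) in
  hv (g y) 0 i = 5 / 4 - wt (hyp_hbar b) / conf_den b (hyp_hbar y) *
    (wt (hyp_hbar y) + 3 / 4 * sqnorm (hv y - hv x) / wt (hyp_hbar x)).
Proof.
move=> b x; rewrite (sqnormB_delta (hv (g y)) i).
have -> : sqnorm (hv (g y)) = 1 - wt (hyp_hbar (g y)) by rewrite /wt; ring.
have gx : hv (g x) = 2^-1 *: delta_mx 0 i by rewrite /x isom_invK.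
have wgx : wt (hyp_hbar (g x)) = 3 / 4.
  by rewrite /wt gx sqnorm_half_basis; field.
have E : sqnorm (hv (g y) - 2^-1 *: delta_mx 0 i) = sqnorm (hv y - hv x) *
    (wt (hyp_hbar (g y)) * (3 / 4)) / (wt (hyp_hbar y) * wt (hyp_hbar x)).
  have := isom_chord g y x; rewrite gx wgx => <-.
  by rewrite mulfK// mulf_neq0// lt0r_neq0// wt_gt0.
rewrite E wt_isom -/b.
have d0 := lt0r_neq0 (conf_den_gt0 b (hyp_hbar y)).
have y0 := lt0r_neq0 (wt_gt0 y); have x0 := lt0r_neq0 (wt_gt0 x).
by field; rewrite d0 y0 x0.
Qed.

(** The formula of [isom_coord] has no pole on the closed ball. *)
Definition isom_ext_val (g : isom R m) (y : Hbar) : 'rV[R]_m :=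
  let b := isom_inv g origin in
  \row_i let x := isom_inv g (half_basis i) in
    (5 / 4 - wt (hyp_hbar b) / conf_den b y *
      (wt y + 3 / 4 * sqnorm (hbar_val y - hv x) / wt (hyp_hbar x))).

Lemma isom_ext_valE g y : isom_ext_val g (hyp_hbar y) = hv (g y).
Proof. by apply/rowP => i; rewrite mxE isom_coord. Qed.

Lemma isom_ext_val_continuous g : continuous (isom_ext_val g).
Proof.
apply: row_continuous => i.
pose b := isom_inv g origin; pose x := isom_inv g (half_basis i).
rewrite (_ : (fun y => _) = (fun y => 5 / 4 - wt (hyp_hbar b) / conf_den b y *
    (wt y + 3 / 4 * sqnorm (hbar_val y - hv x) / wt (hyp_hbar x)))); last first.
  by apply/funext => y; rewrite mxE.
apply: continuous_funB; first exact: cst_continuous.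
apply: continuous_funM.
  apply: continuous_funM; first exact: cst_continuous.
  apply: continuous_funV; first exact: conf_den_continuous.
  by move=> y; exact: conf_den_gt0.
apply: continuous_funD; first exact: wt_continuous.
apply: continuous_funM; last exact: cst_continuous.
apply: continuous_funM; first exact: cst_continuous.
by apply: sqnorm_continuous; exact: hbar_valB_continuous.
Qed.

Lemma shrink_subproof (y : Hbar) (n : nat) :
  (1 - n.+2%:R^-1) *: hbar_val y \in @open_ball R m.
Proof.
apply/mem_set; rewrite /open_ball/= sqnormZ.
have y1 : sqnorm (hbar_val y) <= 1 by exact: (set_mem (valP y)).
have n0 : 0 < n.+2%:R^-1 :> R by rewrite invr_gt0.
have n1 : n.+2%:R^-1 < 1 :> R by rewrite invf_lt1// ltr1n.
set t := n.+2%:R^-1 in n0 n1 *.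
apply: (@le_lt_trans _ _ ((1 - t) ^+ 2)).
  by rewrite -[leRHS]mulr1 ler_wpM2l// sqr_ge0.
by rewrite expr_lt1 ?subr_ge0 ?(ltW n1)//; lra.
Qed.

Definition shrink y n : H := SigSub (shrink_subproof y n).

Lemma shrink_cvg (y : Hbar) : hyp_hbar (shrink y n) @[n --> \oo] --> y.
Proof.
move=> U; rewrite nbhsE => -[V [/(@hbar_initial R m).2[W oW <-] Wy] WU].
have /nbhs_ballP[r /= r0 rW] : nbhs (hbar_val y) W by exact: open_nbhs_nbhs.
have := near_infty_natSinv_lt (PosNum r0); apply: filterS => n /= nr.
apply: WU; apply: rW; split=> // i j; rewrite (ord1 i) /ball/= !mxE.
have y1 : `|hbar_val y 0 j| <= 1.
  rewrite -(@ler_pXn2r _ 2)// ?nnegrE// expr1n real_normK ?num_real//.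
  by apply: le_trans (sqnorm_coord _ _) _; exact: (set_mem (valP y)).
rewrite mulrBl mul1r opprB addrC subrK normrM ger0_norm ?invr_ge0//.
apply: le_lt_trans nr; rewrite -[leRHS]mulr1 ler_pM// ?invr_ge0//.
by rewrite lef_pV2 ?posrE// ler_nat.
Qed.

(** The open ball is dense: a point is the limit of its shrinkings. *)
Lemma hbar_eq_on_hyp (T : topologicalType) (F G : Hbar -> T) :
  hausdorff_space T -> continuous F -> continuous G ->
  (forall x, F (hyp_hbar x) = G (hyp_hbar x)) -> F = G.
Proof.
move=> hT cF cG FG; apply/funext => y.
have c1 : F (hyp_hbar (shrink y n)) @[n --> \oo] --> F y.
  by apply: cvg_comp (@shrink_cvg y) _; exact: cF.
have c2 : G (hyp_hbar (shrink y n)) @[n --> \oo] --> G y.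
  by apply: cvg_comp (@shrink_cvg y) _; exact: cG.
rewrite (funext (fun n => FG (shrink y n))) in c1.
exact: (cvg_unique hT c1 c2).
Qed.

(** The formula of [wt_isom] persists on the closed ball by density; hence the
    extension preserves the closed ball and its boundary. *)
Lemma isom_ext_wt (g : isom R m) (y : Hbar) : 1 - sqnorm (isom_ext_val g y) =
  wt (hyp_hbar (isom_inv g origin)) * wt y / conf_den (isom_inv g origin) y.
Proof.
set b := isom_inv g origin.
have := @hbar_eq_on_hyp R (fun y => 1 - sqnorm (isom_ext_val g y))
  (fun y => wt (hyp_hbar b) * wt y / conf_den b y) (@Rhausdorff R).
move=> H; suff /(congr1 (fun F => F y)) :
  (fun y => 1 - sqnorm (isom_ext_val g y)) =
  (fun y => wt (hyp_hbar b) * wt y / conf_den b y) by [].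
apply: H => [||x].
- apply: continuous_funB; first exact: cst_continuous.
  by apply: sqnorm_continuous; exact: isom_ext_val_continuous.
- apply: continuous_funM.
    by apply: continuous_funM; [exact: cst_continuous|exact: wt_continuous].
  apply: continuous_funV; first exact: conf_den_continuous.
  by move=> z; exact: conf_den_gt0.
- by rewrite isom_ext_valE -wt_isom.
Qed.

Lemma isom_ext_subproof (g : isom R m) (y : Hbar) :
  isom_ext_val g y \in @closed_ball1 R m.
Proof.
apply/mem_set; rewrite /closed_ball1/= -subr_ge0 isom_ext_wt.
rewrite divr_ge0 ?mulr_ge0 ?wt_ge0//.
exact: ltW (conf_den_gt0 _ _).
Qed.

Definition isom_ext (g : isom R m) (y : Hbar) : Hbar := SigSub (isom_ext_subproof g y).

Lemma isom_ext_continuous (g : isom R m) : continuous (isom_ext g).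
Proof.
apply: (initial_map_continuous (@hbar_initial R m)).
exact: isom_ext_val_continuous.
Qed.

Lemma isom_extE (g : isom R m) (x : H) : isom_ext g (hyp_hbar x) = hyp_hbar (g x).
Proof. by apply: val_inj; exact: isom_ext_valE. Qed.

Lemma hbar_hausdorff : hausdorff_space Hbar.
Proof.
by apply: (initial_map_hausdorff (@hbar_initial R m)); exact: val_inj.
Qed.

Lemma isom_ext_uniq (g : isom R m) (G : Hbar -> Hbar) : continuous G ->
  (forall x, G (hyp_hbar x) = hyp_hbar (g x)) -> G = isom_ext g.
Proof.
move=> cG GE; apply: (hbar_eq_on_hyp hbar_hausdorff cG (@isom_ext_continuous g)).
by move=> x; rewrite GE isom_extE.
Qed.

(** Both sides are continuous extensions of the same isometry. *)
Lemma isom_extM (g h : isom R m) (y : Hbar) :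
  isom_ext (g * h)%g y = isom_ext g (isom_ext h y).
Proof.
rewrite -(@isom_ext_uniq (g * h)%g (isom_ext g \o isom_ext h))//.
  by move=> x; apply: continuous_comp; exact: isom_ext_continuous.
by move=> x; rewrite /comp isom_extE isom_extE.
Qed.

Lemma isom_ext1 (y : Hbar) : isom_ext 1%g y = y.
Proof. by rewrite -(@isom_ext_uniq 1%g idfun)// => x; exact: cvg_id. Qed.

Lemma wt_isom_ext (g : isom R m) (y : Hbar) : wt y = 0 -> wt (isom_ext g y) = 0.
Proof. by move=> y0; rewrite /wt [X in sqnorm X]/= isom_ext_wt y0 mulr0 mul0r. Qed.

Lemma bdry_hbar_inj : injective (@bdry_hbar R m).
Proof. by move=> z w /(congr1 (@hbar_val R m)) zw; exact: val_inj. Qed.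

Lemma bdry_actE (g : isom R m) (z : bdry R m) :
  bdry_hbar (bdry_act g z) = isom_ext g (bdry_hbar z).
Proof.
rewrite /bdry_act; case: xgetP => [w _ [G [cG GE <-]]|/(_ _)].
  by rewrite (isom_ext_uniq cG GE).
have [w wE] := wt_eq0 (wt_isom_ext g (wt_bdry z)).
move=> /(_ w); case; exists (isom_ext g); split=> //.
  exact: isom_ext_continuous.
exact: isom_extE.
Qed.

Lemma bdry_actM (g h : isom R m) (z : bdry R m) :
  bdry_act (g * h)%g z = bdry_act g (bdry_act h z).
Proof. by apply: bdry_hbar_inj; rewrite !bdry_actE isom_extM. Qed.

Lemma bdry_hbar_continuous : continuous (@bdry_hbar R m).
Proof.
apply: (initial_map_continuous (@hbar_initial R m)); exact: (@bdry_initial R m).1.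
Qed.

Lemma bdry_act_continuous (g : isom R m) : continuous (@bdry_act R m g).
Proof.
apply: (initial_map_continuous (@bdry_initial R m)).
rewrite (_ : _ \o _ = @hbar_val R m \o (isom_ext g \o @bdry_hbar R m)).
  move=> z; apply: continuous_comp.
    by apply: continuous_comp; [exact: bdry_hbar_continuous|exact: isom_ext_continuous].
  exact: (@hbar_initial R m).1.
by apply/funext => z; rewrite /= -bdry_actE.
Qed.

End isometry_extension.

(** * Differences of distances near the boundary *)

Section distance_asymptotics.
Context (R : realType) (m : nat).
Notation H := (hyp R m).
Notation Hbar := (hbar R m).
Notation hv x := (hbar_val (hyp_hbar x)).

(** The hyperbolic cosine of the distance to [x], multiplied by [wt y] so as to
    have a finite limit at the boundary. *)
Definition cosh_wt (x : H) (y : Hbar) : R :=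
  wt y + 2 * sqnorm (hbar_val y - hv x) / wt (hyp_hbar x).

(** In the same way this is [expR (hdist x y) * wt y] inside the ball, by
    [expR (arcosh t) = t + sqrt (t ^+ 2 - 1)]. *)
Definition exp_dist_wt (x : H) (y : Hbar) : R :=
  cosh_wt x y + Num.sqrt (cosh_wt x y ^+ 2 - wt y ^+ 2).

Lemma cosh_wt_gt0 x y : 0 < cosh_wt x y.
Proof.
rewrite /cosh_wt; have [yx|yx] := eqVneq (hbar_val y) (hv x).
  rewrite ltr_pwDl// ?divr_ge0 ?mulr_ge0 ?sqnorm_ge0 ?wt_ge0//.
  by rewrite /wt yx wt_gt0.
rewrite ltr_wpDl ?wt_ge0// divr_gt0 ?wt_gt0// mulr_gt0// lt_def sqnorm_ge0 andbT.
by rewrite sqnorm_eq0 subr_eq0.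
Qed.

Lemma exp_dist_wt_gt0 x y : 0 < exp_dist_wt x y.
Proof. by rewrite ltr_pwDl ?cosh_wt_gt0// sqrtr_ge0. Qed.

Lemma exp_dist_wt_continuous x : continuous (exp_dist_wt x).
Proof.
have ca : continuous (cosh_wt x).
  apply: continuous_funD; first exact: wt_continuous.
  apply: continuous_funM; last exact: cst_continuous.
  apply: continuous_funM; first exact: cst_continuous.
  by apply: sqnorm_continuous; exact: hbar_valB_continuous.
apply: continuous_funD => //.
have cs : continuous (fun y => cosh_wt x y ^+ 2 - wt y ^+ 2).
  by apply: continuous_funB; apply: continuous_funM => //; exact: wt_continuous.
move=> y; apply: (@continuous_comp Hbar R R
  (fun y => cosh_wt x y ^+ 2 - wt y ^+ 2) (@Num.sqrt R)); first exact: cs.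
exact: sqrt_continuous.
Qed.

Lemma exp_dist_wtE (x y : H) :
  expR (hdist x y) * wt (hyp_hbar y) = exp_dist_wt x (hyp_hbar y).
Proof.
rewrite hdistE sqnormBC /arcosh.
set w := wt (hyp_hbar y).
have w0 : 0 < w by exact: wt_gt0.
have x0 : 0 < wt (hyp_hbar x) by exact: wt_gt0.
set t := 1 + _.
have tE : t * w = cosh_wt x (hyp_hbar y).
  rewrite /t /cosh_wt -/w; field.
  by rewrite !lt0r_neq0.
have t1 : 1 <= t.
  by rewrite lerDl divr_ge0 ?mulr_ge0 ?sqnorm_ge0// ltW.
rewrite lnK; last by rewrite posrE ltr_pwDl ?sqrtr_ge0// (lt_le_trans ltr01).
rewrite mulrDl /exp_dist_wt -/w -tE; congr (_ + _).
rewrite -[X in _ * X](ger0_norm (ltW w0)) -sqrtr_sqr -sqrtrM.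
  by congr Num.sqrt; ring.
by rewrite subr_ge0 exprn_ege1.
Qed.

(** Inside the ball this is [hdist x y - hdist x' y], since the weights cancel
    in the quotient. On the boundary it is the Busemann cocycle. *)
Definition dist_diff (x x' : H) (y : Hbar) : R :=
  ln (exp_dist_wt x y / exp_dist_wt x' y).

Lemma dist_diffE x x' (y : H) :
  dist_diff x x' (hyp_hbar y) = hdist x y - hdist x' y.
Proof.
rewrite /dist_diff -!exp_dist_wtE.
rewrite -mulf_div divff ?lt0r_neq0 ?wt_gt0// mulr1 -expRN -expRD.
exact: expRK.
Qed.

Lemma dist_diff_continuous x x' : continuous (dist_diff x x').
Proof.
have c : continuous (fun y => exp_dist_wt x y / exp_dist_wt x' y).
  apply: continuous_funM; first exact: exp_dist_wt_continuous.
  apply: continuous_funV; first exact: exp_dist_wt_continuous.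
  by move=> y; exact: exp_dist_wt_gt0.
move=> y; apply: (@continuous_comp Hbar R R _ (@ln R)); first exact: c.
by apply: continuous_ln; rewrite divr_gt0 ?exp_dist_wt_gt0.
Qed.

Lemma dist_diff_bnd x x' : exists2 L, 0 <= L & forall y, `|dist_diff x x' y| <= L.
Proof.
have [f fc] := hbar_cantor R m.
have [L LP] := cantor_image_bnd fc (@dist_diff_continuous x x').
by exists L => //; exact: le_trans (normr_ge0 _) (LP (hyp_hbar x)).
Qed.

(** By compactness. At interior points this reads
    [c <= expR (hdist x y) * wt y], so that [wt] is bounded below at bounded
    distance from [x]. *)
Lemma exp_dist_wt_ge x : exists2 c, 0 < c & forall y, c <= exp_dist_wt x y.
Proof.
have [f fc] := hbar_cantor R m.
have ci : continuous (fun y => (exp_dist_wt x y)^-1).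
  apply: continuous_funV; first exact: exp_dist_wt_continuous.
  by move=> y; exact: exp_dist_wt_gt0.
have [B BP] := cantor_image_bnd fc ci.
have B0 : 0 < B.
  apply: lt_le_trans (BP (hyp_hbar x)).
  by rewrite normr_gt0 invr_neq0// lt0r_neq0// exp_dist_wt_gt0.
exists B^-1; first by rewrite invr_gt0.
move=> y; rewrite -[leRHS]invrK lef_pV2 ?posrE ?invr_gt0 ?exp_dist_wt_gt0//.
by apply: le_trans (BP y); rewrite ler_norm.
Qed.

End distance_asymptotics.

Lemma expR_dist1 (R : realType) (t k : R) : `|t| <= k ->
  `|expR t - 1| <= expR k - 1.
Proof.
rewrite ler_norml => /andP[kt tk].
have h1 : expR t <= expR k by rewrite ler_expR.
have h2 : expR (- k) <= expR t by rewrite ler_expR.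
have p := expR_gt0 k; have q := expR_gt0 (- k).
have pq : expR k * expR (- k) = 1 by rewrite -expRD subrr expR0.
have : 2 <= expR k + expR (- k).
  have := sqr_ge0 (expR k - 1); nra.
by move=> ?; rewrite ler_norml; apply/andP; split; lra.
Qed.

(** The part of Patterson's conditions that makes the modification
    disappear in ratios at infinity. *)
Definition slowly_varying (R : realType) (h : R -> {posnum R}) :=
  (forall r r', 0 < r -> r <= r' -> (h r)%:num <= (h r')%:num) /\
  (forall e, 0 < e -> exists2 r0 : R, 0 < r0 &
    forall r t, r0 <= r -> 1 <= t -> (h (t * r))%:num <= t `^ e * (h r)%:num).

Section poincare_ratio.
Context (R : realType) (m : nat).
Variables (h : R -> {posnum R}) (O x : hyp R m).
Hypothesis hslow : slowly_varying h.

Definition modif_ratio (y : hyp R m) : R :=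
  (h (expR (hdist x y)))%:num / (h (expR (hdist O y)))%:num.

Lemma modif_ratio_gt0 y : 0 < modif_ratio y.
Proof. by rewrite divr_gt0. Qed.

(** The arguments of [h] differ by a factor at most [expR L], which slow
    variation turns into a factor at most [expR (e * L)] once both are large. *)
Lemma modif_ratio_far e L : 0 < e -> 0 <= L ->
  (forall y, `|dist_diff O x y| <= L) ->
  exists2 r1, 0 < r1 & forall y, r1 <= expR (hdist O y) ->
    `|ln (modif_ratio y)| <= e * L.
Proof.
move=> e0 L0 LP; have [r0 r00 hr0] := hslow.2 e e0.
exists (r0 * expR L); first by rewrite mulr_gt0 ?expR_gt0.
move=> y yr.
have := LP (hyp_hbar y); rewrite dist_diffE ler_norml => /andP[d1 d2].
have Or : r0 <= expR (hdist O y).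
  by apply: le_trans yr; rewrite ler_peMr ?(ltW r00)// -expR0 ler_expR.
have xr : r0 <= expR (hdist x y).
  rewrite -(@ler_pM2r _ (expR L)) ?expR_gt0//; apply: (le_trans yr).
  by rewrite -expRD ler_expR; lra.
have step a b : r0 <= expR a -> `|b - a| <= L ->
    (h (expR b))%:num <= expR (e * L) * (h (expR a))%:num.
  move=> ar; rewrite ler_norml => /andP[ba1 ba2].
  have [ab|ab] := leP a b.
    rewrite -[X in expR X](subrK a) expRD (le_trans (hr0 _ _ ar _))//.
      by rewrite -expR0 ler_expR subr_ge0.
    rewrite ler_wpM2r// /powR gt_eqF ?expR_gt0// expRK ler_expR.
    by rewrite ler_wpM2l// ltW.
  apply: (le_trans (hslow.1 _ (expR a) (expR_gt0 _) _)).
    by rewrite ler_expR ltW.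
  by rewrite ler_peMl// -expR0 ler_expR mulr_ge0// ltW.
have p := modif_ratio_gt0 y.
rewrite ler_norml -ler_expR -[X in _ && X]ler_expR lnK ?posrE//.
apply/andP; split.
  rewrite /modif_ratio ler_pdivlMr// expRN mulrC ler_pdivrMr ?expR_gt0//.
  by rewrite mulrC step// ler_norml; apply/andP; split; lra.
rewrite /modif_ratio ler_pdivrMr// step// ler_norml.
by apply/andP; split; lra.
Qed.

(** As [s] tends to [delta], the ratio of the terms at [x] and at [O] of the
    modified series tends to its value without modification. Far from [O] this
    is uniform by [modif_ratio_far]. Near [O] the error is merely bounded, but
    there [wt] is bounded below by [exp_dist_wt_ge]; the term [C * wt] absorbs
    it, and vanishes on the boundary, where the limit measures live. *)
Lemma poincare_ratio_cvg delta e : 0 < e ->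
  exists C eta, [/\ 0 <= C, 0 < eta & forall s y, `|s - delta| < eta ->
    `|modif_ratio y * expR (s * dist_diff O x (hyp_hbar y)) -
      expR (delta * dist_diff O x (hyp_hbar y))| <= e + C * wt (hyp_hbar y)].
Proof.
move=> e0; have [L L0 LP] := dist_diff_bnd O x.
(* [K] bounds the limit; [k] is such that [K * (expR k - 1) = e], and [e1] such
   that the modification and the change of exponent contribute at most [k / 2]
   each. *)
pose K := expR (`|delta| * L).
have K0 : 0 < K by exact: expR_gt0.
pose k := ln (1 + e / K).
have eK : 0 < e / K by exact: divr_gt0.
have k0 : 0 < k by rewrite ln_gt0// ltrDl.
have L1 : 0 < 2 * (L + 1) by rewrite mulr_gt0// ltr_wpDl.
pose e1 := k / (2 * (L + 1)).
have e10 : 0 < e1 by rewrite divr_gt0.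
have e1L : e1 * L <= k / 2.
  rewrite /e1 mulrAC ler_pdivrMr// (_ : k / 2 * _ = k * (L + 1)); last by field.
  by rewrite ler_wpM2l ?(ltW k0)// lerDl.
have [r1 r10 far] := modif_ratio_far e10 L0 LP.
have [c c0 cP] := exp_dist_wt_ge O.
(* [M] bounds [modif_ratio] where [expR (hdist O y) < r1], as [h] is monotone
   and [c] is a lower bound of [expR (hdist O y)]. *)
pose M := (h (r1 * expR L))%:num / (h c)%:num.
pose M' := M * expR ((`|delta| + 1) * L) + K.
have M'0 : 0 < M' by rewrite addr_gt0// mulr_gt0 ?expR_gt0// divr_gt0.
exists (M' * (r1 / c)), (Num.min 1 e1).
split; first by rewrite mulr_ge0 ?divr_ge0// ltW.
  by rewrite lt_min ltr01.
move=> s y; rewrite lt_min => /andP[s1 se].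
set d := dist_diff O x (hyp_hbar y).
have dL : `|d| <= L by exact: LP.
have dK : expR (delta * d) <= K.
  rewrite ler_expR (le_trans (ler_norm _))// normrM ler_wpM2l//.
have w0 : 0 < wt (hyp_hbar y) by exact: wt_gt0.
have [yr|yr] := leP r1 (expR (hdist O y)).
  have H1 := far _ yr.
  apply: (@le_trans _ _ e); last first.
    by rewrite lerDl mulr_ge0 ?(ltW w0)// mulr_ge0 ?divr_ge0// ltW.
  have -> : modif_ratio y * expR (s * d) - expR (delta * d) =
      expR (delta * d) * (expR (ln (modif_ratio y) + (s - delta) * d) - 1).
    rewrite mulrBr mulr1 -expRD; congr (_ - _).
    rewrite (_ : _ + _ = ln (modif_ratio y) + s * d); last by ring.
    by rewrite expRD lnK// posrE modif_ratio_gt0.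
  rewrite normrM ger0_norm ?expR_ge0//.
  have H2 : `|ln (modif_ratio y) + (s - delta) * d| <= k.
    rewrite (le_trans (ler_normD _ _))// normrM.
    have : `|s - delta| * `|d| <= e1 * L by rewrite ler_pM// ltW.
    by move: e1L H1; lra.
  apply: (le_trans (ler_pM (expR_ge0 _) (normr_ge0 _) dK (expR_dist1 H2))).
  rewrite /k lnK ?posrE ?addr_gt0// [1 + _]addrC addrK.
  by rewrite mulrCA divff ?mulr1// lt0r_neq0.
(* From here on [y] is near [O]. *)
have wc : c <= r1 * wt (hyp_hbar y).
  apply: (le_trans (cP (hyp_hbar y))); rewrite -exp_dist_wtE.
  by rewrite ler_wpM2r ?ltW.
apply: (@le_trans _ _ (M' * (r1 / c * wt (hyp_hbar y)))); last first.
  by rewrite mulrA lerDr ltW.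
apply: (@le_trans _ _ M'); last first.
  rewrite ler_peMr ?(ltW M'0)// mulrAC ler_pdivlMr// mul1r//.
apply: (le_trans (ler_normB _ _)); rewrite lerD//; last first.
  by rewrite ger0_norm ?expR_ge0.
rewrite normrM ler_pM//.
  rewrite ger0_norm ?(ltW (modif_ratio_gt0 _))// /M /modif_ratio.
  rewrite ler_pM// ?invr_ge0//.
    apply: hslow.1; first exact: expR_gt0.
    have := dL; rewrite /d dist_diffE ler_norml => /andP[d1 d2].
    apply: (@le_trans _ _ (expR (hdist O y) * expR L)).
      by rewrite -expRD ler_expR; lra.
    by rewrite ler_wpM2r ?expR_ge0// ltW.
  rewrite lef_pV2 ?posrE//; apply: hslow.1 => //.
  have := exp_dist_wtE O y; have := cP (hyp_hbar y) => + E; rewrite -E => /le_trans.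
  apply; rewrite ler_piMr ?expR_ge0// gerBl; exact: sqnorm_ge0.
rewrite ger0_norm ?expR_ge0// ler_expR (le_trans (ler_norm _))// normrM ler_pM//.
have := s1; rewrite -{2}(subrK delta s) => ?.
by rewrite (le_trans (ler_normD _ _))// addrC lerD// ltW.
Qed.

End poincare_ratio.

(** * Limits of weighted sums along an ultrafilter *)

(** For each [n], finitely many terms are at least [n.+1%:R^-1]. *)
Lemma esum_countable (R : realType) (T : choiceType) (D : set T) (a : T -> R) :
  (forall i, D i -> 0 < a i) -> (\esum_(i in D) (a i)%:E < +oo)%E ->
  countable D.
Proof.
move=> a0 aoo.
pose E n := [set i | D i /\ n.+1%:R^-1 <= a i].
have -> : D = \bigcup_n E n.
  apply/seteqP; split=> [i Di|i [n _ []]//].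
  have [N _ /(_ N (leqnn N)) /= NP] := near_infty_natSinv_lt (PosNum (a0 i Di)).
  by exists N => //; split=> //; exact: ltW.
apply: bigcup_countable => // n _; apply: finite_set_countable.
apply: contrapT => infE.
have s0 : (0 <= \esum_(i in D) (a i)%:E)%E.
  by apply: esum_ge0 => i /a0 /ltW; rewrite lee_fin.
pose S := fine (\esum_(i in D) (a i)%:E).
have SE : (\esum_(i in D) (a i)%:E = S%:E)%E by rewrite fineK// ge0_fin_numE.
pose N := (Num.truncn (S * n.+1%:R)).+1.
have [A AE NA] := infinite_set_fset N infE.
pose s := finmap.enum_fset A.
have sE i : i \in s -> E n i by exact: AE.
have : (\sum_(i <- s) (a i)%:E <= S%:E)%E.
  rewrite -SE; apply: esum_ge; exists [set` s].
    by split; [exact: finite_seq|move=> i /sE[]].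
  by rewrite fsbig_seq//; exact: finmap.fset_uniq.
apply/negP; rewrite -ltNge sumEFin lte_fin.
apply: (@lt_le_trans _ _ (\sum_(i <- s) n.+1%:R^-1)).
  rewrite big_const_seq count_predT iter_addr_0 -(mulr_natl _ (size s)).
  rewrite ltr_pdivlMr//.
  by rewrite (lt_le_trans (truncnS_gt _))// ler_nat.
by rewrite [leLHS]big_seq [leRHS]big_seq; apply: ler_sum => i /sE[].
Qed.

Section weighted_sums.
Context (R : realType) (I : choiceType) (D : set I) (e : nat -> I).
Hypothesis eD : set_bij [set: nat] D e.

(** Sums over [D] are integrals for a measure on [nat], through the enumeration
    [e]; every function on [nat] is measurable. *)
Definition weighted (w : I -> {nonneg R}) : {measure set nat -> \bar R} :=
  mseries (fun n => mscale (w (e n)) (\d_n : {measure set nat -> \bar R})) 0.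

Lemma sum_dirac_weighted d (T : measurableType d) (w : I -> {nonneg R})
    (p : I -> T) A : sum_dirac D w p A = weighted w ((p \o e) @^-1` A).
Proof.
rewrite /sum_dirac (reindex_esum _ _ _ _ eD) -nneseries_esumT//.
by move=> n; rewrite mule_ge0// lee_fin.
Qed.

Lemma integral_weighted (w : I -> {nonneg R}) (f : I -> R) :
  (forall i, 0 <= f i) ->
  (\int[weighted w]_n (f (e n))%:E = \esum_(i in D) ((w i)%:num * f i)%:E)%E.
Proof.
move=> f0; have mf : measurable_fun [set: nat] (fun n => (f (e n))%:E) by [].
have f0' n : (0 <= (f (e n))%:E)%E by rewrite lee_fin.
rewrite /weighted ge0_integral_measure_series// (reindex_esum _ _ _ _ eD).
rewrite -nneseries_esumT; last by move=> n; rewrite lee_fin mulr_ge0.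
apply: eq_eseriesr => n _.
by rewrite ge0_integral_mscale// integral_dirac// diracT mul1e EFinM.
Qed.

End weighted_sums.

(** An ultrafilter gives a limit for all bounded functions at once, and the
    limits are automatically linear and monotone. *)
Section ultra_mean.
Context (R : realType) (U : set_system R).
Context {UU : UltraFilter U}.
Context (I : Type) (e : nat -> I) (M : R -> {measure set nat -> \bar R}) (C : R).
Hypothesis MC : \forall s \near U, (M s setT <= C%:E)%E.

Let PU : ProperFilter U := ultra_proper.
Local Existing Instance PU.

Definition ultra_mean (F : I -> R) : R :=
  lim ((fun s => \int[M s]_n F (e n)) @ U).

Let integrableF (s : R) (F : I -> R) : (M s setT <= C%:E)%E -> bnd F ->
  (M s).-integrable setT (EFin \o (fun n => F (e n))).
Proof.
move=> sC [B FB]; have soo : (M s setT < +oo)%E := le_lt_trans sC (ltry C).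
by apply: (bounded_integrable soo) => // n; exact: FB.
Qed.

Lemma bounded_ultra_cvg (f : R -> R) (B : R) :
  (\forall s \near U, `|f s| <= B) -> cvg (f @ U).
Proof.
move=> fB; have fU : (f @ U) `[- B, B]%classic.
  by apply: (@filterS _ U _ _ _ _ fB) => s; rewrite ler_norml /= in_itv.
have [a [_ ca]] := @segment_compact R (- B) B (f @ U) _ fU.
apply/cvg_ex; exists a => V aV.
have [//|nV] := in_ultra_setVsetC (f @^-1` V) UU.
by have [t []] := ca (~` V) V nV aV.
Qed.

Lemma ultra_mean_cvg F : bnd F ->
  \int[M s]_n F (e n) @[s --> U] --> ultra_mean F.
Proof.
move=> bF; have [B FB] := bF.
apply: (@bounded_ultra_cvg _ (B * C)).
apply: (@filterS _ U _ _ _ _ MC) => s sC.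
have soo : (M s setT < +oo)%E := le_lt_trans sC (ltry C).
have mF : measurable_fun [set: nat] (fun n => F (e n)) by [].
apply: (le_trans (normr_Rintegral_le soo mF (fun n => FB (e n)))).
rewrite ler_wpM2l//; first exact: le_trans (normr_ge0 _) (FB (e 0%N)).
by rewrite -lee_fin fineK// ge0_fin_numE.
Qed.

Lemma ultra_mean_eq F (f : R -> R) l : bnd F ->
  (\forall s \near U, \int[M s]_n F (e n) = f s) -> f @ U --> l ->
  ultra_mean F = l.
Proof.
move=> bF Ff fl; apply: (cvg_unique (@Rhausdorff R) (ultra_mean_cvg bF)).
apply: cvg_trans fl; apply: near_eq_cvg.
by apply: (@filterS _ U _ _ _ _ Ff) => s ->.
Qed.

Lemma ultra_mean_is_mean : is_mean ultra_mean.
Proof.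
split.
- move=> F G bF bG; apply: (ultra_mean_eq (bndD bF bG)); last first.
    exact: cvgD (ultra_mean_cvg bF) (ultra_mean_cvg bG).
  apply: (@filterS _ U _ _ _ _ MC) => s sC.
  by rewrite RintegralD//; exact: integrableF.
- move=> c F bF; apply: (ultra_mean_eq (bndM (bnd_cst _ c) bF)); last first.
    exact: cvgM (cvg_cst c) (ultra_mean_cvg bF).
  apply: (@filterS _ U _ _ _ _ MC) => s sC.
  by rewrite RintegralZl//; exact: integrableF.
- move=> F G bF bG FG.
  have c1 := ultra_mean_cvg bF; have c2 := ultra_mean_cvg bG.
  have := @ler_cvg_to R U _ R _ _ _ _ c1 c2; apply.
  apply: (@filterS _ U _ _ _ _ MC) => s sC.
  by apply: le_Rintegral => //; exact: integrableF.
Qed.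

End ultra_mean.

(** * The mean defined by the Patterson construction *)

(** The inverse of an enumeration of isometries takes a default value. *)
HB.instance Definition _ (R : realType) m := isPointed.Build (isom R m) 1%g.

Lemma no_modif_slowly_varying (R : realType) : slowly_varying (@no_modif R).
Proof.
split=> // e e0; exists 1 => // r t _ t1.
rewrite /= mulr1 /powR gt_eqF ?(lt_le_trans _ t1)//.
by rewrite -[leLHS]expR0 ler_expR mulr_ge0 ?ln_ge0// ltW.
Qed.

Section patterson_mean.
Context (R : realType) (k : nat) (O : hyp R k.+1).
Variables (Gamma : set (isom R k.+1))
  (mu : hyp R k.+1 -> {finite_measure set (borel (bdry R k.+1)) -> \bar R}).
Hypothesis Gamma_group : group_closed (mem Gamma).
Hypothesis Gamma_infinite : infinite_set Gamma.
Hypothesis mu_PS : patterson_sullivan Gamma O mu.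

Let delta := critical_exponent Gamma O.

(** Both cases of Patterson's construction are limits along a filter of
    exponents, which extends to an ultrafilter. *)
Lemma patterson_ultrafilter : exists h (U : set_system R),
  [/\ slowly_varying h, UltraFilter U, U --> delta &
    weak_lim U (patterson_approx Gamma h O O) (mu O)].
Proof.
have [_ _ _ _ [_ _ [H1 H2]]] := mu_PS.
have [/H1/(_ O) H|/H2[h [h1 _ _ h4] [s_ [_ sdelta /(_ O) H]]]] := pselect
    (poincare_series Gamma (@no_modif R) O O s @[s --> delta^'+] --> +oo%E).
  have [U [UU FU]] := ultraFilterLemma (@at_right_proper_filter R delta).
  exists (@no_modif R), U; split=> //.
  - exact: no_modif_slowly_varying.
  - by move=> V dV; apply: FU; apply: (@filterS _ (nbhs delta) _ V).
  - move=> phi cphi V /(H phi cphi)/=; exact: FU.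
have [U [UU FU]] := ultraFilterLemma (fmap_proper_filter s_ _ : ProperFilter (s_ @ \oo)).
exists h, U; split=> //.
- by move=> V dV; apply: FU; exact: sdelta.
- by move=> phi cphi V /(H phi cphi) VV; apply: FU.
Qed.

Lemma Gamma_translate g : Gamma g ->
  set_bij Gamma Gamma (fun ga => (g^-1 * ga)%g).
Proof.
move=> Gg.
have GM a b : Gamma a -> Gamma b -> Gamma (a * b)%g.
  move=> /mem_set aG /mem_set bG; apply: set_mem.
  exact: (group_closedM Gamma_group).
have GV a : Gamma a -> Gamma a^-1%g.
  by move=> /mem_set aG; apply: set_mem; exact: (group_closedV Gamma_group).
split=> [a Ga|a b _ _ /mulgI//|a Ga]; first exact: GM (GV _ Gg) Ga.
by exists (g * a)%g; [exact: GM|rewrite mulKg].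
Qed.

(** The last property is the transformation rule of Patterson measures, at the
    level of the group. Translating the summation variable by [g] replaces the
    weight of [ga] by that of [g^-1 * ga], which is the weight of [ga] seen from
    [g O] instead of [O]. The quotient of the two tends to
    the conformal factor by [poincare_ratio_cvg], up to an arbitrarily small
    constant and a multiple of [wt], whose mean is 0 because it vanishes on
    the boundary. *)
Lemma patterson_mean : exists (m : (isom R k.+1 -> R) -> R) (e : nat -> isom R k.+1),
  [/\ is_mean m, set_bij [set: nat] Gamma e,
    forall F G, (forall g, Gamma g -> F g = G g) -> m F = m G,
    forall phi : hbar R k.+1 -> R, continuous phi ->
      m (fun g => phi (hyp_hbar (g O))) = \int[mu O]_z phi (bdry_hbar z) &
    forall g F, Gamma g -> bnd F -> (forall ga, 0 <= F ga) ->
      m (fun ga => F (g * ga)%g) =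
      m (fun ga => F ga * expR (delta * dist_diff O (g O) (hyp_hbar (ga O))))].
Proof.
have [h [U [hslow UU Udelta HU]]] := patterson_ultrafilter.
have PU : ProperFilter U := ultra_proper.
have muT : mu O setT = 1%E by have [] := mu_PS.
have [f0 f0c] := hbar_cantor R k.+1.
pose w s (ga : isom R k.+1) := NngNum (poincare_term_ge0 h O (ga O) s).
pose c s := NngNum (poincare_series_fine_ge0 Gamma h O O s).
pose p (ga : isom R k.+1) : borel (hbar R k.+1) := hyp_hbar (ga O).
have HT : patterson_approx Gamma h O O s setT @[s --> U] --> 1%E.
  have := HU (cst 1) (@cst_continuous _ _ _).
  rewrite (_ : (\int[mu O]_z (cst 1 (bdry_hbar z))%:E)%E = 1%E); last first.
    transitivity (\int[mu O]_z (cst 1%E z))%E; first by [].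
    by rewrite integral_cst// mul1e.
  apply: cvg_trans; apply: near_eq_cvg; apply: nearW => s.
  transitivity (\int[patterson_approx Gamma h O O s]_z (cst 1%E z))%E; first by [].
  by rewrite integral_cst// mul1e.
(* A divergent series would make the approximating measures zero, whereas their
   masses tend to 1. *)
have cntG : countable Gamma.
  have [s s0] : exists s, (0 < patterson_approx Gamma h O O s setT)%E.
    apply: (@filter_ex _ U); apply: (HT [set x | (0 < x)%E]).
    by apply: open_nbhs_nbhs; split; [exact: open_ereal_gt_ereal|exact: lte01].
  apply: (@esum_countable R _ Gamma (fun ga => poincare_term h O (ga O) s)).
    by move=> ga _; rewrite mulr_gt0// expR_gt0.
  rewrite ltey; apply/negP => /eqP soo; move: s0.
  rewrite (_ : patterson_approx _ _ _ _ _ _ =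
    ((fine (poincare_series Gamma h O O s))^-1%:E *
     sum_dirac Gamma (w s) p setT)%E); last by [].
  by rewrite /poincare_series soo/= invr0 mul0e ltxx.
(* The normalized weights as measures on [nat]. *)
have [e eG] : exists e, set_bij [set: nat] Gamma e.
  apply/card_set_bijP; rewrite card_eq_sym; exact: eq_card_nat.
pose M s : {measure set nat -> \bar R} := mscale (c s) (weighted e (w s)).
have approxE s A : patterson_approx Gamma h O O s A = M s ((p \o e) @^-1` A).
  by congr (_ * _)%E; exact: (sum_dirac_weighted eG (w s) p A).
have MC : \forall s \near U, (M s setT <= 2%:E)%E.
  have : \forall s \near U, (patterson_approx Gamma h O O s setT < 2%:E)%E.
    apply: (HT [set x | (x < 2%:E)%E]).
    by apply: open_nbhs_nbhs; split; [exact: open_ereal_lt_ereal|rewrite /= lte_fin; lra].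
  by apply: filterS => s /ltW; rewrite approxE preimage_setT.
have apI s (phi : hbar R k.+1 -> R) : (M s setT <= 2%:E)%E -> continuous phi ->
    \int[patterson_approx Gamma h O O s]_y phi y = \int[M s]_n phi (p (e n)).
  move=> sC cphi; have soo : (M s setT < +oo)%E := le_lt_trans sC (ltry 2).
  have [B phiB] := cantor_image_bnd f0c cphi.
  have E : Measure.sort (patterson_approx Gamma h O O s) =
      pushforward (M s) (p \o e) by apply/funext => A; exact: approxE.
  have mphi := continuous_borelR cphi.
  rewrite /Rintegral E integral_pushforward//; first exact/measurable_EFinP.
  by apply: (bounded_integrable soo) => // n; exact: phiB.
pose m := ultra_mean U e M.
have mm : is_mean m by exact: ultra_mean_is_mean MC.
have mloc F G : (forall g, Gamma g -> F g = G g) -> m F = m G.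
  move=> FG; rewrite /m /ultra_mean; congr (lim (_ @ U)).
  apply/funext => s; congr Rintegral; apply/funext => n; apply: FG.
  by have [eG1 _ _] := eG; exact: eG1.
have mweak (phi : hbar R k.+1 -> R) : continuous phi ->
    m (fun g => phi (hyp_hbar (g O))) = \int[mu O]_z phi (bdry_hbar z).
  move=> cphi; have [B phiB] := cantor_image_bnd f0c cphi.
  have bphi : bnd (fun g : isom R k.+1 => phi (hyp_hbar (g O))) by exists B.
  apply: (@ultra_mean_eq R U UU _ e M 2 MC _
    (fun s => \int[patterson_approx Gamma h O O s]_y phi y)) => //.
    by apply: filterS MC => s sC; rewrite apI.
  have muOoo : (mu O setT < +oo)%E by rewrite muT ltry.
  have cphib : continuous (fun z : bdry R k.+1 => phi (bdry_hbar z)).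
    move=> z; apply: continuous_comp; first exact: bdry_hbar_continuous.
    exact: cphi.
  have ig := bounded_integrable muOoo (continuous_borelR cphib)
    (fun z => phiB (bdry_hbar z)).
  by apply: fine_cvg; rewrite fineK; [exact: HU|exact: integrable_fin_num ig].
exists m, e; split; [exact: mm|exact: eG|exact: mloc|exact: mweak|].
move=> g F Gg bF F0.
pose dd (ga : isom R k.+1) := dist_diff O (g O) (hyp_hbar (ga O)).
(* The quotient of the weights of [g^-1 * ga] and of [ga]. *)
pose rho s (ga : isom R k.+1) := modif_ratio h O (g O) (ga O) * expR (s * dd ga).
have rho_ge0 s ga : 0 <= rho s ga.
  by rewrite mulr_ge0 ?expR_ge0// ltW// modif_ratio_gt0.
have [L L0 LP] := dist_diff_bnd O (g O).
have bexp s : bnd (fun ga => expR (s * dd ga)).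
  exists (expR (`|s| * L)) => ga; rewrite ger0_norm ?expR_ge0// ler_expR.
  by rewrite (le_trans (ler_norm _))// normrM ler_wpM2l// LP.
have wrho s ga : poincare_term h O ((g^-1 * ga)%g O) s = (w s ga)%:num * rho s ga.
  have -> : (g^-1 * ga)%g O = (g^-1)%g (ga O) by [].
  have dE : hdist O ((g^-1)%g (ga O)) = hdist (g O) (ga O).
    rewrite -(isom_dist g).
    by have -> : g ((g^-1)%g (ga O)) = (g * g^-1)%g (ga O) by []; rewrite mulgV.
  rewrite /poincare_term dE /rho /dd dist_diffE /modif_ratio /w /poincare_term /=.
  rewrite mulrBr expRD !mulNr !expRN.
  have h0 := lt0r_neq0 (gt0 (h (expR (hdist O (ga O))))).
  have x0 := lt0r_neq0 (expR_gt0 (s * hdist O (ga O))).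
  have y0 := lt0r_neq0 (expR_gt0 (s * hdist (g O) (ga O))).
  by field; rewrite y0 x0 h0.
have shiftI s : \int[M s]_n F (g * e n)%g = \int[M s]_n (F (e n) * rho s (e n)).
  have sc (G : isom R k.+1 -> R) : (forall ga, 0 <= G ga) ->
      (\int[M s]_n (G (e n))%:E =
       (c s)%:num%:E * \int[weighted e (w s)]_n (G (e n))%:E)%E.
    by move=> G0; rewrite ge0_integral_mscale// => n _; rewrite lee_fin.
  have Fr0 ga : 0 <= F ga * rho s ga by rewrite mulr_ge0.
  congr fine; rewrite (sc (fun ga => F (g * ga)%g))//.
  rewrite (sc (fun ga => F ga * rho s ga))//.
  congr (_ * _)%E.
  rewrite (integral_weighted eG (w s) (f := fun ga => F (g * ga)%g))//.
  rewrite (integral_weighted eG (w s) (f := fun ga => F ga * rho s ga))//.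
  rewrite (reindex_esum _ _ _ _ (Gamma_translate Gg)).
  apply: eq_esum => ga Gga; rewrite mulVKg.
  have -> : (w s (g^-1 * ga)%g)%:num = (w s ga)%:num * rho s ga by exact: wrho.
  by rewrite -mulrA [rho s ga * _]mulrC.
have [B FB] := bF.
have B0 : 0 <= B by exact: le_trans (normr_ge0 _) (FB 1%g).
pose F1 (ga : isom R k.+1) := F (g * ga)%g.
pose F2 (ga : isom R k.+1) := F ga * expR (delta * dd ga).
have bF1 : bnd F1 by exact: bnd_comp bF.
have bF2 : bnd F2 := bndM bF (bexp delta).
apply/eqP; rewrite -subr_eq0 -normr_le0 -/F1 -/F2.
apply/ler_addgt0Pr => e1 e10; rewrite add0r.
(* [W] bounds the error made when [rho s] is replaced by its limit; the weak
   limit sees only its boundary value [B * e2], which is less than [e1]. *)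
pose e2 := e1 / (B + 1).
have e20 : 0 < e2 by rewrite divr_gt0// ltr_wpDl.
have [C [eta [C0 eta0 HC]]] := poincare_ratio_cvg O (g O) hslow delta e20.
pose W (ga : isom R k.+1) := B * (e2 + C * wt (hyp_hbar (ga O))).
have wt1 (y : hbar R k.+1) : `|wt y| <= 1.
  by rewrite ger0_norm ?wt_ge0// gerBl sqnorm_ge0.
have bW : bnd W.
  apply: bndM; first exact: bnd_cst.
  apply: bndD; first exact: bnd_cst.
  by apply: bndM; [exact: bnd_cst|exists 1 => ga].
have mW : m W = B * e2.
  rewrite /W (meanZ mm).
    congr (_ * _).
    rewrite (mweak (fun y => e2 + C * wt y)).
      under eq_Rintegral do rewrite wt_bdry mulr0 addr0.
      transitivity (e2 * fine (mu O setT)); last by rewrite muT mulr1.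
      exact: Rintegral_cst.
    apply: continuous_funD; first exact: cst_continuous.
    by apply: continuous_funM; [exact: cst_continuous|exact: wt_continuous].
  apply: bndD; first exact: bnd_cst.
  by apply: bndM; [exact: bnd_cst|exists 1 => ga].
apply: (@le_trans _ _ (m W)); last first.
  rewrite mW /e2 mulrCA ler_piMr ?(ltW e10)// ler_pdivrMr ?mul1r ?lerDl//.
  by rewrite ltr_wpDl.
have c1 := @ultra_mean_cvg R U UU _ e M 2 MC _ bF1.
have c2 := @ultra_mean_cvg R U UU _ e M 2 MC _ bF2.
have cW := @ultra_mean_cvg R U UU _ e M 2 MC _ bW.
have := @ler_cvg_to R U _ R _ _ _ _ (cvg_norm (cvgB c1 c2)) cW; apply.
have nd : \forall s \near U, `|s - delta| < eta.
  have : \forall s \near delta, `|s - delta| < eta.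
    by near=> s; rewrite distrC; near: s; exact: cvgr_dist_lt.
  by move=> /Udelta.
apply: filterS2 MC nd => s sC sd.
have soo : (M s setT < +oo)%E := le_lt_trans sC (ltry 2).
have ig (G : isom R k.+1 -> R) : bnd G ->
    (M s).-integrable setT (EFin \o (fun n => G (e n))).
  by move=> [D GD]; apply: (bounded_integrable soo) => // n; exact: GD.
have FW ga : `|F ga * rho s ga - F2 ga| <= W ga.
  by rewrite /F2 -mulrBr normrM ler_pM// HC.
have bFr : bnd (fun ga => F ga * rho s ga).
  have [D WD] := bndD (bnd_norm bF2) bW; exists D => ga.
  apply: le_trans (WD ga); rewrite (le_trans _ (ler_norm _))//.
  rewrite -(subrK (F2 ga) (F ga * rho s ga)).
  by rewrite (le_trans (ler_normD _ _))// addrC lerD2l.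
have sh : \int[M s]_n F1 (e n) = \int[M s]_n (F (e n) * rho s (e n)).
  exact: shiftI.
change (`|\int[M s]_n F1 (e n) - \int[M s]_n F2 (e n)| <= \int[M s]_n W (e n)).
rewrite sh -RintegralB//; [|exact: ig bFr|exact: ig bF2].
have bdiff : bnd (fun ga => F ga * rho s ga - F2 ga).
  exact: bndD bFr (bndN bF2).
apply: (le_trans (le_normr_Rintegral measurableT (ig _ bdiff))).
apply: le_Rintegral => //; [exact: ig _ (bnd_norm bdiff)|exact: ig].
Unshelve. all: end_near. Qed.

End patterson_mean.

(** * Equivariance of the disintegration *)

(** [lam] is a disintegration of the joint law of [p] and [q] over [mu]. The
    transformation [s] of the indices lifts [G] on [Z], acts as [tau] on the
    values of [q], and changes the mean by the density [r]. *)
Section equivariance.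
Context (R : realType) (I : Type) (m : (I -> R) -> R).
Hypothesis mm : is_mean m.
Context (k : nat) (Z T : ptopologicalType) (e : Z -> 'rV[R]_k).
Context (fZ : cantor_space -> Z) (fT : cantor_space -> T) (p : I -> Z) (q : I -> T).
Hypotheses (eZ : initial_map e) (fZi : cantor_image fZ) (fTi : cantor_image fT).
Variable mu : {finite_measure set (borel Z) -> \bar R}.
Hypothesis muE : forall phi : Z -> R, continuous phi ->
  \int[mu]_z phi z = m (fun i => phi (p i)).
Variable lam : Z -> {finite_measure set (borel T) -> \bar R}.
Hypotheses (lamT : forall z, lam z setT = 1%E)
  (mlam : forall phi : T -> R, continuous phi ->
     measurable_fun setT ((fun z => \int[lam z]_w phi w) : borel Z -> R))
  (lamI : forall (F : Z -> R) (phi : T -> R), continuous F ->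
     (forall z, 0 <= F z) -> continuous phi ->
     \int[mu]_z (F z * \int[lam z]_w phi w) = m (fun i => F (p i) * phi (q i))).
Variables (s : I -> I) (r : Z -> R) (G G' : Z -> Z) (tau : T -> T).
Hypotheses (cr : continuous r) (r0 : forall z, 0 <= r z)
  (cG : continuous G) (cG' : continuous G') (GK : cancel G G')
  (ctau : continuous tau) (ps : forall i, p (s i) = G (p i))
  (mq : forall F phi, m (fun i => F (p i) * phi (q (s i))) =
                      m (fun i => F (p i) * phi (tau (q i))))
  (ms : forall F, bnd F -> (forall i, 0 <= F i) ->
     m (fun i => F (s i)) = m (fun i => F i * r (p i))).

Lemma fibre_integral01 (phi : T -> R) z : continuous phi ->
  (forall w, 0 <= phi w <= 1) -> 0 <= \int[lam z]_w phi w <= 1.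
Proof.
move=> cphi phi01.
have lamoo : (lam z setT < +oo)%E by rewrite lamT ltry.
have phiB w : `|phi w| <= 1 by have /andP[? ?] := phi01 w; rewrite ger0_norm.
have ip := bounded_integrable lamoo (continuous_borelR cphi) phiB.
apply/andP; split.
  by apply: Rintegral_ge0 => w _; have /andP[] := phi01 w.
have E : \int[lam z]_w (cst 1 w) = 1.
  by transitivity (1 * fine (lam z setT));
    [exact: Rintegral_cst|rewrite lamT mulr1].
rewrite -[leRHS]E; apply: le_Rintegral => //.
  by apply: (bounded_integrable lamoo (B := 1)) => // w; rewrite /= normr1.
by move=> w _; have /andP[] := phi01 w.
Qed.

(** Let [F] be continuous on [Z] and put [K = F o G^-1]. Quasi-invariance for
    the marginal turns the integral of [F * xi o G] into that of
    [K * r * xi], where [xi] is the integral of [phi] over the fibre.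
    This is the mean of [K(p) * r(p) * phi(q)], which quasi-invariance for the
    joint law turns back into the mean of [F(p) * phi(tau q)]. *)
Lemma disintegration_equivariant (phi : T -> R) : continuous phi ->
  (forall w, 0 <= phi w <= 1) ->
  {ae (mu : {measure set (borel Z) -> \bar R}), forall z,
     \int[lam (G z)]_w phi w = \int[lam z]_w phi (tau w)}.
Proof.
move=> cphi phi01.
have muoo : (mu setT < +oo)%E by rewrite -ge0_fin_numE// fin_num_measure.
have cphit : continuous (fun w => phi (tau w)).
  by move=> w; apply: continuous_comp; [exact: ctau|exact: cphi].
pose xi z := \int[lam z]_w phi w.
pose xi' z := \int[lam z]_w phi (tau w).
have xi01 z : 0 <= xi z <= 1 by exact: fibre_integral01.
have xi'01 z : 0 <= xi' z <= 1 by exact: fibre_integral01.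
have bxi : bnd xi.
  by exists 1 => z; have /andP[? ?] := xi01 z; rewrite ger0_norm.
have bxi' : bnd xi'.
  by exists 1 => z; have /andP[? ?] := xi'01 z; rewrite ger0_norm.
have mxi := mlam cphi; have mxi' := mlam cphit.
have mG : measurable_fun setT (G : borel Z -> borel Z) by exact: continuous_borel.
have bnds (F : Z -> R) : continuous F -> bnd F := cantor_image_bnd fZi.
apply: (continuous_separate_ae eZ (D1 := fun z => xi (G z)) (D2 := xi')) => //.
- exact: measurableT_comp mxi mG.
- exact: bnd_comp bxi.
move=> F cF F0.
have [gm [gmE gmI]] := finite_pushforward muoo mG.
pose K z := F (G' z).
have cK : continuous K.
  by move=> z; apply: continuous_comp; [exact: cG'|exact: cF].
have K0 z : 0 <= K z by exact: F0.
have KG z : K (G z) = F z by rewrite /K GK.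
have quasi (Q : Z -> R) : continuous Q -> (forall z, 0 <= Q z) ->
    \int[gm]_z Q z = \int[mu]_z (Q z * r z).
  move=> cQ Q0; have [B QB] := bnds Q cQ.
  rewrite (gmI _ B) ?(muE (continuous_funM cQ cr))//; last first.
    exact: continuous_borelR.
  have cQG : continuous (fun z => Q (G z)).
    by move=> z; apply: continuous_comp; [exact: cG|exact: cQ].
  rewrite (muE cQG) -(ms (F := fun i => Q (p i)))//; last by exists B.
  by congr m; apply/funext => i; rewrite ps.
have gmoo : (gm setT < +oo)%E by rewrite gmE preimage_setT.
have cKr : continuous (fun z => K z * r z) by exact: continuous_funM.
(* [quasi] is about continuous functions only, and [xi] is just measurable. *)
have key : \int[gm]_z (xi z * K z) = \int[mu]_z (xi z * (K z * r z)).
  apply: (tests_separate eZ (D1 := K) (D2 := fun z => K z * r z)) => //.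
  - exact: continuous_borelR.
  - exact: continuous_borelR.
  - exact: bnds.
  - exact: bnds.
  - exact: quasi.
  - move=> j.
    have ct : continuous (fun z => test j (e z)).
      by apply: test_continuous; exact: eZ.1.
    rewrite (quasi (fun z => test j (e z) * K z)); last first.
    + by move=> z; rewrite mulr_ge0//; have /andP[] := test01 j (e z).
    + exact: continuous_funM.
    by congr Rintegral; apply/funext => z; rewrite mulrA.
have [B HB] := bndM bxi (bnds K cK).
transitivity (\int[gm]_z (xi z * K z)).
  rewrite (gmI _ B)//.
    by congr Rintegral; apply/funext => z; rewrite KG mulrC.
  by apply: measurable_funM => //; exact: continuous_borelR.
rewrite key (lamI cF F0 cphit) -(mq F phi).
transitivity (\int[mu]_z ((K z * r z) * xi z)).
  by congr Rintegral; apply/funext => z; rewrite mulrC.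
rewrite lamI//; last by move=> z; rewrite mulr_ge0.
transitivity (m (fun i => K (p i) * phi (q i) * r (p i))).
  by congr m; apply/funext => i; rewrite mulrAC.
rewrite -(ms (F := fun i => K (p i) * phi (q i))).
- by congr m; apply/funext => i; rewrite ps KG.
- apply: bndM; [exact: bnd_comp (bnds K cK)|].
  by apply: bnd_comp; exact: cantor_image_bnd fTi cphi.
- by move=> i; rewrite mulr_ge0//; have /andP[] := phi01 (q i).
Qed.

End equivariance.

(** * Developing measures *)

Theorem theorem1p1 (R : realType) (k n : nat) (O : hyp R k.+1)
    (Gamma : set (isom R k.+1)) (Gamma_group : group_closed (mem Gamma))
    (Gamma_infinite : infinite_set Gamma)
    (Gamma_nonelementary : nonelementary Gamma)
    (Gamma_discrete : discrete_group Gamma)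
    (mu : hyp R k.+1 -> {finite_measure set (borel (bdry R k.+1)) -> \bar R})
    (mu_PS : patterson_sullivan Gamma O mu)
    (rho : isom R k.+1 -> isom R n.+1)
    (rho_morph : {in Gamma &, {morph rho : g h / (g * h)%g}}) :
  exists lambda : bdry R k.+1 ->
      {finite_measure set (borel (bdry R n.+1)) -> \bar R},
    developing_measures O Gamma rho mu lambda.
Proof.
have [m [e [mm eG mloc mweak mquasi]]] :=
  patterson_mean Gamma_group Gamma_infinite mu_PS.
have muT : mu O setT = 1%E by have [] := mu_PS.
have muOoo : (mu O setT < +oo)%E by rewrite muT ltry.
have [fZ fZc] := hbar_cantor R k.+1; have [fT fTc] := bdry_cantor R n.
have miota : measurable_fun setT
    (@bdry_hbar R k.+1 : borel (bdry R k.+1) -> borel (hbar R k.+1)).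
  by apply: continuous_borel; exact: bdry_hbar_continuous.
pose p (g : isom R k.+1) := hyp_hbar (g O).
pose q (g : isom R k.+1) : bdry R n.+1 := bdry_act (rho g) point.
(* The disintegration is over the closed ball, where the orbit lives, and is
   then restricted to the boundary. *)
have [mu' [mu'E mu'I]] := finite_pushforward muOoo miota.
have muE (phi : hbar R k.+1 -> R) : continuous phi ->
    \int[mu']_y phi y = m (fun g => phi (p g)).
  move=> cphi; have [B phiB] := cantor_image_bnd fZc cphi.
  by rewrite (mu'I _ B)//; [rewrite mweak|exact: continuous_borelR].
have [lam [lamT mlam lamI]] :=
  mean_disintegration mm (@hbar_initial R k.+1) fZc muE q fTc.
have equi g (phi : bdry R n.+1 -> R) : Gamma g -> continuous phi ->
    (forall w, 0 <= phi w <= 1) ->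
    {ae (mu O : {measure set (borel (bdry R k.+1)) -> \bar R}), forall z,
      \int[lam (bdry_hbar (bdry_act g z))]_w phi w =
      \int[lam (bdry_hbar z)]_w phi (bdry_act (rho g) w)}.
  move=> Gg cphi phi01.
  pose r y := expR (critical_exponent Gamma O * dist_diff O (g O) y).
  have cr : continuous r.
    move=> y; apply: (@continuous_comp _ _ _
      (fun y => critical_exponent Gamma O * dist_diff O (g O) y) expR).
      by apply: continuous_funM; [exact: cst_continuous|exact: dist_diff_continuous].
    exact: continuous_expR.
  have H : {ae (mu' : {measure set (borel (hbar R k.+1)) -> \bar R}), forall y,
      \int[lam (isom_ext g y)]_w phi w = \int[lam y]_w phi (bdry_act (rho g) w)}.
    apply: (@disintegration_equivariant R _ m _ _ _ _ fZ fT p q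
      (@hbar_initial R k.+1) fZc fTc mu' muE lam lamT mlam lamI
      (fun ga => g * ga)%g r (isom_ext g) (isom_ext g^-1%g) (bdry_act (rho g))).
    - exact: cr.
    - by move=> y; exact: expR_ge0.
    - exact: isom_ext_continuous.
    - exact: isom_ext_continuous.
    - by move=> y; rewrite -isom_extM mulVg isom_ext1.
    - exact: bdry_act_continuous.
    - by move=> ga; rewrite /p isom_extE.
    - move=> F psi; apply: mloc => ga Gga; congr (_ * psi _).
      by rewrite /q rho_morph ?bdry_actM// inE.
    - by move=> F bF F0; exact: mquasi.
    - exact: cphi.
    - exact: phi01.
  have [N [mN N0 HN]] := H.
  exists (@bdry_hbar R k.+1 @^-1` N); split.
  - by rewrite -[X in measurable X]setTI; exact: miota.
  - by rewrite -[LHS]mu'E.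
  - by move=> z Hz; apply: HN => /= E; apply: Hz => /=; rewrite bdry_actE.
exists (fun z => lam (bdry_hbar z)); split.
- have Ge i : Gamma (e i) by have [eG1 _ _] := eG; exact: eG1.
  have tc (j : test_index n.+1) :
      continuous (fun w : bdry R n.+1 => test j (bdry_val w)).
    by apply: test_continuous; exact: (@bdry_initial R n.+1).1.
  (* One null set for all elements of the group and all test functions. *)
  have H := @ae_forall_countable _ _ _ (mu O) _
    (fun (ij : nat * test_index n.+1) z =>
      \int[lam (bdry_hbar (bdry_act (e ij.1) z))]_w test ij.2 (bdry_val w) =
      \int[lam (bdry_hbar z)]_w test ij.2 (bdry_val (bdry_act (rho (e ij.1)) w)))
    (fun ij => equi (e ij.1) (fun w => test ij.2 (bdry_val w)) (Ge ij.1)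
       (tc ij.2) (fun w => test01 ij.2 (bdry_val w))).
  apply: (@filterS _ _ (ae_filter_ringOfSetsType (mu O)) _ _ _ H) => z Hz g Gg A mA.
  have [_ _ eG3] := eG; have [i _ ig] := eG3 g Gg.
  have lamoo y : (lam y setT < +oo)%E by rewrite lamT ltry.
  have mact : measurable_fun setT
      (bdry_act (rho g) : borel (bdry R n.+1) -> borel (bdry R n.+1)).
    by apply: continuous_borel; exact: bdry_act_continuous.
  have [nu [nuE nuI]] := finite_pushforward (lamoo (bdry_hbar z)) mact.
  have nuT : nu setT = 1%E by rewrite nuE preimage_setT; exact: lamT.
  have nuoo : (nu setT < +oo)%E by rewrite nuT ltry.
  rewrite /pushforward -nuE.
  apply: (tests_separate_measures (@bdry_initial R n.+1)) => //.
  + exact: lamoo.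
  + by transitivity (1%E : \bar R); [exact: lamT|exact: esym nuT].
  + move=> j; rewrite (nuI _ 1).
    * by have := Hz (i, j); rewrite /= ig.
    * exact: continuous_borelR (tc j).
    * by move=> w; have /andP[? ?] := test01 j (bdry_val w); rewrite ger0_norm.
- move=> phi cphi; have [B phiB] := cantor_image_bnd fTc cphi.
  have lamoo y : (lam y setT < +oo)%E by rewrite lamT ltry.
  have ig y := bounded_integrable (lamoo y) (continuous_borelR cphi) phiB.
  rewrite (_ : (fun z => _) = EFin \o (fun z => \int[lam (bdry_hbar z)]_w phi w)).
    apply: (@bounded_integrable _ _ _ _ _ B) => //.
      exact: measurableT_comp (mlam _ cphi) miota.
    move=> z; apply: (le_trans (normr_Rintegral_le (lamoo (bdry_hbar z))
      (continuous_borelR cphi) phiB)).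
    rewrite (_ : fine _ = 1) ?mulr1//.
    exact: (congr1 fine (lamT (bdry_hbar z))).
  by apply/funext => z /=; rewrite fineK//; exact: integrable_fin_num (ig _).
- rewrite (_ : (fun z => _) = cst 1); last by apply/funext => z; rewrite lamT.
  rewrite inE/=; apply/andP; split; rewrite inE//=.
  rewrite /finite_norm unlock /=; case: ifPn => [mu0|//].
  have -> : abse \o (EFin \o cst 1) = cst 1%E :> (bdry R k.+1 -> \bar R).
    by apply/funext => z; rewrite /= normr1.
  by rewrite ess_sup_cst// ltry.
- by apply: aeW => z; rewrite lamT.
Qed.
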